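(* Let $\varphi_1,\dots,\varphi_n$ be $n$ analytically independent meromorphic functions on $\mathbb{C}^n$ such that the mapping $\Phi=(\varphi_1,\dots,\varphi_n)$ admits an algebraic addition theorem (AAT). Then: (a) Any $n+1$ of the $n^2+n$ functions $\varphi_1(u),\dots,\varphi_n(u)$ and $\frac{\partial\varphi_k}{\partial u_p}(u)$ $(k,p=1,\dots,n)$ are algebraically dependent. (b) Each function $\varphi_k(u)$ is algebraically dependent on its $n$ first-order partial derivatives $\frac{\partial\varphi_k}{\partial u_p}(u)$, $p=1,\dots,n$. (c) Each one of the $n^2$ first-order partial derivatives $\frac{\partial\varphi_k}{\partial u_p}(u)$ $(k,p=1,\dots,n)$ is algebraically dependent on the $n$ functions $\varphi_1(u),\dots,\varphi_n(u)$.
   Context: Here $u=(u_1,\dots,u_n)\in\mathbb{C}^n$. Meromorphic functions $\varphi_1,\dots,\varphi_n$ on $\mathbb{C}^n$ are analytically independent if the Jacobian determinant $\det[\partial\varphi_k/\partial u_p]$ does not vanish identically. They define the meromorphic mapping $\Phi:u\mapsto(\varphi_1(u),\dots,\varphi_n(u))$ from $\mathbb{C}^n$ to $\overline{\mathbb{C}}^n$ (the product of $n$ Riemann spheres). $\Phi$ admits an algebraic addition theorem (AAT) if there exist $n$ polynomials $G_k(\lambda;x_1,\dots,x_n,y_1,\dots,y_n)\not\equiv 0$, $k=1,\dots,n$, in $2n+1$ variables with complex coefficients such that $$G_k\{\varphi_k(u+v);\varphi_1(u),\dots,\varphi_n(u),\varphi_1(v),\dots,\varphi_n(v)\}=0,\qquad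 k=1,\dots,n,$$ identically as meromorphic functions of $(u,v)\in\mathbb{C}^n\times\mathbb{C}^n$ (none of the denominators vanishing identically). Meromorphic functions $f_0,\dots,f_m$ on $\mathbb{C}^n$ are algebraically dependent if there is a nonzero polynomial $P$ in $m+1$ variables with complex coefficients such that $P(f_0,\dots,f_m)\equiv0$; ''$f_0$ is algebraically dependent on $f_1,\dots,f_m$'' means that $f_0,f_1,\dots,f_m$ are algebraically dependent. *)

(* Defs.v *)
(* The notations of mpoly.v clash with those of
   MathComp-Analysis and are therefore not imported. *)
From mathcomp Require Import all_boot all_order all_algebra.
From mathcomp Require Import all_classical all_reals all_analysis.
From mathcomp Require Import complex.
From mathcomp Require Export -(notations) mpoly.
Export numFieldNormedType.Exports.

Set Implicit Arguments.
Unset Strict Implicit.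
Unset Printing Implicit Defensive.

Import Order.TTheory GRing.Theory Num.Theory.

Local Open Scope classical_set_scope.
Local Open Scope ring_scope.

(* Packing R[i] as a numClosedFieldType lets it inherit the normed-module
   structure that MathComp-Analysis puts on every numFieldType; in particular
   [differentiable] below is complex differentiability. *)
Definition CC (R : realType) : numClosedFieldType := R[i].

Section Meromorphic.
Variables (R : realType) (n : nat).
Local Notation C := (CC R).
Local Notation Cn := 'rV[C]_n.
Implicit Types (f g h : Cn -> C) (a u v : Cn).

Definition holomorphic_at f a : Prop := \forall u \near a, differentiable f u.

(* A meromorphic function is represented by a total function that is, near each
   point, a quotient g / h of holomorphic germs with h a nonzero germ.  The
   values taken where h vanishes are arbitrary: no value is assigned to poles
   and points of indeterminacy.  The points where f is holomorphic form a dense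
   open set; relations between meromorphic functions are accordingly stated at
   all the points where the functions involved are holomorphic. *)
Definition meromorphic f : Prop :=
  forall a, exists g h,
    [/\ holomorphic_at g a, holomorphic_at h a,
        ~ (\forall u \near a, h u = 0)
      & \forall u \near a, h u != 0 -> f u = g u / h u].

Definition partial (p : 'I_n) f : Cn -> C := fun u => 'D_('e_p) f u.

Definition jacobian_mx (phi : 'I_n -> Cn -> C) u : 'M[C]_n :=
  \matrix_(k < n, p < n) partial p (phi k) u.

Definition analytically_independent (phi : 'I_n -> Cn -> C) : Prop :=
  exists u, (forall k, holomorphic_at (phi k) u) /\ \det (jacobian_mx phi u) != 0.

Definition aat_point (l : C) (x y : 'I_n -> C) : 'I_(1 + (n + n)) -> C :=
  fun i => match fintype.split i with
           | inl _ => l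
           | inr j => match fintype.split j with inl p => x p | inr q => y q end
           end.

(* The points (u, v) quantified over form a dense open subset of C^n x C^n when
   the phi k are meromorphic. *)
Definition admits_AAT (phi : 'I_n -> Cn -> C) : Prop :=
  exists G : 'I_n -> mpoly (1 + (n + n)) C,
    forall k, G k != 0 /\
      forall u v,
        (forall i, holomorphic_at (phi i) u) ->
        (forall i, holomorphic_at (phi i) v) ->
        holomorphic_at (phi k) (u + v) ->
        meval (aat_point (phi k (u + v)) (phi^~ u) (phi^~ v)) (G k) = 0.

Definition alg_dependent (m : nat) (f : 'I_m -> Cn -> C) : Prop :=
  exists P : mpoly m C, P != 0 /\
    forall u, (forall i, holomorphic_at (f i) u) -> meval (f^~ u) P = 0.

Definition alg_dependent_on (m : nat) f0 (f : 'I_m -> Cn -> C) : Prop :=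
  alg_dependent (fun i : 'I_m.+1 => oapp f f0 (unlift ord0 i)).

Definition phi_and_partials (phi : 'I_n -> Cn -> C)
    (i : 'I_n + 'I_n * 'I_n) : Cn -> C :=
  match i with
  | inl k => phi k
  | inr (k, p) => partial p (phi k)
  end.

End Meromorphic.

(* Main.v *)
Require Import Defs.
From mathcomp Require Import all_boot all_order all_algebra.
From mathcomp Require Import all_classical all_reals all_analysis.
From mathcomp Require Import complex ring lra zify.

(* Each phi_k(u + b) is algebraic over the field generated by the
   phi_j(u), for a generic constant b, by the addition theorem; differentiating
   the addition theorem in v at v = b expresses every partial derivative of
   phi_k at u + b rationally through phi_k(u + b) and the phi_j(u). So all the
   n^2 + n functions, translated by b, are algebraic over a field generated by n
   functions, and any n + 1 of them are algebraically dependent; translating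
   back gives (a), and (b), (c) are instances of (a).

   The relations hold where certain polynomials in the phi_j do not vanish, so
   the identity theorem for meromorphic functions is needed. For functions of
   one complex variable it is obtained as follows: by Goursat's lemma, g has a
   primitive H, and H is twice differentiable, so that the maximum principle
   holds for H and its multiples H / z^n by a second difference argument;
   if H vanishes near 0, letting n tend to infinity gives H = 0 and g = 0. *)

Import Order.TTheory GRing.Theory Num.Theory.
Import numFieldNormedType.Exports.
Set Implicit Arguments.
Unset Strict Implicit.
Unset Printing Implicit Defensive.
Local Open Scope classical_set_scope.
Local Open Scope ring_scope.
Local Open Scope complex_scope.
Local Notation Re := complex.Re.
Local Notation Im := complex.Im.

(** * Goursat's lemma *)

(** Complex differentiability gives only a first-order expansion of [g], too weak for a second
    difference. A primitive gains exactly one order, so neither the Cauchy formula nor power series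
    are called upon.

    Meromorphic functions are total functions with arbitrary values at their poles and do not form a
    field here. Transcendence degree is therefore replaced by a count of monomials against a
    dimension, made on a set of points where no denominator vanishes; density extends the relation
    afterwards.

    The translation by [b] is there because the derivatives of the [phi j] at [v = b] are constants:
    the differentiated addition theorem then involves only [phi k (u + b)], its derivative and the
    [phi j u]. For each [k], two functions of [(u, v)] must not vanish identically: the leading
    coefficient in lambda of the relation, and its derivative in lambda. The first uses analytic
    independence, the second also the minimality of the relation. Independence enters through
    first-order variations along lines: they move the point [(phi u, phi v)] off the zero set of a
    nonzero polynomial, which takes the place of an inverse function theorem. *)

Section Bisection.
Variables (R : realType) (S : R -> R -> R).

(** For [S = P - Q], with [P] and [Q] the partial integrals of a form [p dx + q dy], this is minus
    the counterclockwise integral of the form along the boundary of the rectangle. It is additive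
    under subdivision. *)
Definition mixed_diff (r : R * R * R * R) : R :=
  let: (a, b, c, d) := r in S b d - S b c - S a d + S a c.

Definition bisect (r : R * R * R * R) : R * R * R * R :=
  let: (a, b, c, d) := r in
  let m := (a + b) / 2 in let n := (c + d) / 2 in
  let big r' := `|mixed_diff r| / 4 <= `|mixed_diff r'| in
  if big (a, m, c, n) then (a, m, c, n) else
  if big (m, b, c, n) then (m, b, c, n) else
  if big (a, m, n, d) then (a, m, n, d) else (m, b, n, d).

(** By additivity the four quarters cannot all fall below a fourth of the total, so the last branch
    of [bisect] needs no test. *)
Lemma bisect_mixed_diff r : `|mixed_diff r| / 4 <= `|mixed_diff (bisect r)|.
Proof.
case: r => [[[a b] c] d]; rewrite /bisect.
set m := (a + b) / 2; set n := (c + d) / 2.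
case: ifPn => // /negP H1; case: ifPn => // /negP H2; case: ifPn => // /negP H3.
rewrite leNgt; apply/negP => H4.
move: H1 H2 H3 => /negP; rewrite -ltNge => H1 /negP; rewrite -ltNge => H2.
move=> /negP; rewrite -ltNge => H3.
have : `|mixed_diff (a, b, c, d)| <=
   `|mixed_diff (a, m, c, n)| + `|mixed_diff (m, b, c, n)|
   + `|mixed_diff (a, m, n, d)| + `|mixed_diff (m, b, n, d)|.
  have -> : mixed_diff (a, b, c, d) = mixed_diff (a, m, c, n)
     + mixed_diff (m, b, c, n) + mixed_diff (a, m, n, d) + mixed_diff (m, b, n, d).
    by rewrite /mixed_diff; ring.
  do 2!(apply: le_trans (ler_normD _ _) _; rewrite lerD2r).
  exact: ler_normD.
lra.
Qed.

(** Nested rectangles shrink to a point and keep at least [4 ^- k] of the mixed difference, while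
    the local hypothesis makes it negligible against the squared size, which also scales like
    [4 ^- k]. *)
Lemma mixed_diff_eq0 a b c d : a <= b -> c <= d ->
  (forall x y, a <= x <= b -> c <= y <= d ->
     forall e : R, 0 < e -> exists2 dl : R, 0 < dl &
       forall a' b' c' d' : R, a <= a' <= x -> x <= b' <= b -> c <= c' <= y -> y <= d' <= d ->
        (b' - a') + (d' - c') < dl ->
        `|mixed_diff (a', b', c', d')| <= e * ((b' - a') + (d' - c')) ^+ 2) ->
  mixed_diff (a, b, c, d) = 0.
Proof.
move=> ab cd loc; apply/eqP; rewrite -normr_eq0; apply/negPn/negP => D0.
pose r k := iter k bisect (a, b, c, d).
pose A k := (r k).1.1.1; pose B k := (r k).1.1.2.
pose C k := (r k).1.2; pose E k := (r k).2.
have rE k : r k = (A k, B k, C k, E k) by rewrite /A /B /C /E; case: (r k) => [[[]]].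
have rS k : r k.+1 = bisect (A k, B k, C k, E k) by rewrite -rE.
have step k : [/\ A k <= B k, C k <= E k & True] ->
    [/\ A k <= A k.+1, A k.+1 <= B k.+1, B k.+1 <= B k & B k.+1 - A k.+1 = (B k - A k) / 2]
    /\ [/\ C k <= C k.+1, C k.+1 <= E k.+1, E k.+1 <= E k & E k.+1 - C k.+1 = (E k - C k) / 2].
  case=> AB CE _.
  have := rS k; rewrite [r k.+1]rE /bisect.
  by case: ifP => _; [|case: ifP => _; [|case: ifP => _]];
    case=> -> -> -> ->; split; split; lra.
have ord k : [/\ A k <= B k, C k <= E k & True].
  elim: k => [|k IH]; first by split.
  by have [[? ? ? _] [? ? ? _]] := step k IH; split.
have len k : (B k - A k) + (E k - C k) = ((b - a) + (d - c)) / 2 ^+ k.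
  elim: k => [|k IH]; first by rewrite expr0 divr1.
  have [[_ _ _ ->] [_ _ _ ->]] := step k (ord k).
  rewrite -mulrDl IH exprS; field.
  by rewrite expf_neq0.
have big k : `|mixed_diff (a, b, c, d)| / 4 ^+ k <= `|mixed_diff (r k)|.
  elim: k => [|k IH]; first by rewrite expr0 divr1.
  apply: le_trans (bisect_mixed_diff (r k)).
  rewrite exprS invfM mulrCA mulrC ler_pM2r ?invr_gt0 //; exact: IH.
have mono k l : (k <= l)%N -> [/\ A k <= A l, B l <= B k, C k <= C l & E l <= E k].
  elim: l => [|l IH]; first by rewrite leqn0 => /eqP ->.
  rewrite leq_eqVlt => /orP[/eqP -> //|]; rewrite ltnS => /IH[h1 h2 h3 h4].
  have [[? _ ? _] [? _ ? _]] := step l (ord l).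
  by split; [exact: le_trans h1 _|exact: le_trans h2|exact: le_trans h3 _|exact: le_trans h4].
have cross k l : A k <= B l /\ C k <= E l.
  have [kl|/ltnW lk] := leqP k l.
    by have [? ? ? ?] := mono _ _ kl; have [? ? _] := ord l; split; lra.
  by have [? ? ? ?] := mono _ _ lk; have [? ? _] := ord k; split; lra.
pose x := sup (range A); pose y := sup (range C).
have Ax k : A k <= x <= B k.
  apply/andP; split.
    apply: ub_le_sup; last by exists k.
    by exists (B k) => _ [j _ <-]; case: (cross j k).
  by apply: ge_sup; [exists (A 0%N), 0%N | move=> _ [j _ <-]; case: (cross j k)].
have Cy k : C k <= y <= E k.
  apply/andP; split.
    apply: ub_le_sup; last by exists k.
    by exists (E k) => _ [j _ <-]; case: (cross j k).
  by apply: ge_sup; [exists (C 0%N), 0%N | move=> _ [j _ <-]; case: (cross j k)].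
have Lpos : 0 < (b - a) + (d - c).
  rewrite lt_neqAle eq_sym; apply/andP; split; last by lra.
  apply: contraNneq D0 => L0; have -> : b = a by lra.
  have -> : d = c by lra.
  by rewrite normr_eq0 /mixed_diff; apply/eqP; ring.
set L := (b - a) + (d - c) in Lpos len.
have D0' : 0 < `|mixed_diff (a, b, c, d)| by rewrite lt_neqAle eq_sym D0 normr_ge0.
set D := `|mixed_diff (a, b, c, d)| in D0 D0' big.
(* With this value the local bound on the [k]-th rectangle, of half-perimeter [L / 2 ^+ k], is half
   of the lower bound [D / 4 ^+ k]. *)
have e0 : 0 < D / (2 * L ^+ 2) by rewrite divr_gt0 // mulr_gt0 // exprn_gt0.
have [dl dl0 Hdl] := loc x y (Ax 0%N) (Cy 0%N) _ e0.
have [k Hk] : exists k, L / 2 ^+ k < dl.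
  exists (Num.bound (L / dl)).
  rewrite ltr_pdivrMr ?exprn_gt0 // mulrC -ltr_pdivrMr //.
  have h : 0 <= L / dl by rewrite divr_ge0 // ltW.
  apply: lt_trans (archi_boundP h) _.
  by rewrite -natrX ltr_nat ltn_expl.
have [/andP[? ?] /andP[? ?]] := (Ax k, Cy k).
have [? ? ? ?] := mono 0%N k (leq0n k).
have := Hdl (A k) (B k) (C k) (E k).
rewrite len -rE => /(_ _ _ _ _ Hk) H.
have {H}H : `|mixed_diff (r k)| <= D / (2 * L ^+ 2) * (L / 2 ^+ k) ^+ 2.
  by apply: H; apply/andP; split => //; rewrite /A/B/C/E /= in mono *; lra.
have := le_trans (big k) H.
have -> : D / (2 * L ^+ 2) * (L / 2 ^+ k) ^+ 2 = (D / 4 ^+ k) / 2.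
  have -> : (4 : R) = 2 ^+ 2 by rewrite expr2; ring.
  rewrite -exprM mulnC exprM; field.
  by rewrite expf_neq0 // gt_eqF.
have : 0 < D / 4 ^+ k by rewrite divr_gt0 // exprn_gt0.
lra.
Qed.

End Bisection.

(** * Integrals of real functions compared with affine approximations *)

Section Primitive.
Variables (R : realType) (A0 : R).

(** Below [A0] the interval is empty and the value is 0, not a signed integral; hence the conditions
    [A0 < x] in what follows. *)
Definition prim (k : R -> R) (x : R) : R := (\int[lebesgue_measure]_(t in `[A0, x]) k t)%R.

Lemma is_derive_prim k x : continuous k -> A0 < x -> is_derive x 1 (prim k) (k x).
Proof.
move=> kc Ax.
have ki : lebesgue_measure.-integrable `[A0, (x + 1)] (EFin \o k).
  apply: continuous_compact_integrable; first exact: segment_compact.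
  exact: continuous_subspaceT.
have := @continuous_FTC1_closed R k A0 x (x + 1) _ ki Ax (kc x).
rewrite ltrDl ltr01 => /(_ isT)[d1 d2].
by apply: (DeriveDef d1); rewrite -d2 derive1E.
Qed.

(** The mean value theorem, applied to [prim k] minus the primitive of the affine function, turns
    the pointwise bound into a bound on the increment. *)
Lemma prim_diff_approx k (al be m a b : R) : continuous k -> A0 < a -> a <= b ->
  (forall x, a <= x <= b -> `|k x - (al + be * x)| <= m) ->
  `|prim k b - prim k a - (al * (b - a) + be * (b ^+ 2 - a ^+ 2) / 2)| <= m * (b - a).
Proof.
move=> kc Aa ab; case: (ltgtP a b) ab => // [ab|<-] _ Hk; last first.
  by rewrite !subrr !mulr0 mul0r !(subrr, addr0, mulr0) normr0.
pose G x := prim k x - (al * x + be / 2 * x ^+ 2).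
pose dG x := k x - (al + be * x).
have GD x : a <= x -> is_derive x 1 G (dG x).
  move=> ax; have kd := is_derive_prim kc (lt_le_trans Aa ax).
  have d2 : is_derive x 1 (fun x : R => be / 2 * x ^+ 2) (be * x).
    apply: is_derive_eq.
    by rewrite /GRing.scale /=; field.
  have d1 : is_derive x 1 (fun x : R => al * x) al.
    by apply: is_derive_eq; rewrite /GRing.scale /= mulr1.
  exact: is_deriveB kd (is_deriveD d1 d2).
have [c cab E] : exists2 c, c \in `]a, b[ & G b - G a = dG c * (b - a).
  apply: MVT ab _ _.
    by move=> x /itvP xab; apply: GD; rewrite xab.
  apply: derivable_within_continuous => x /itvP xab.
  by apply: (@ex_derive _ _ _ _ _ _ (dG x)); apply: GD; rewrite xab.
have -> : prim k b - prim k a - (al * (b - a) + be * (b ^+ 2 - a ^+ 2) / 2) = G b - G a.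
  by rewrite /G; field.
rewrite E normrM [`|b - a|]ger0_norm ; last by rewrite subr_ge0 ltW.
rewrite ler_pM2r ?subr_gt0 //.
by apply: Hk; move: cab; rewrite in_itv /= => /andP[/ltW -> /ltW ->].
Qed.
End Primitive.

(** * Primitives of closed forms on a square *)

Section ClosedForm.
Variables (R : realType) (r : R) (p q : R -> R -> R).

(* [p dx + q dy] is differentiable at (x, y) and closed there: the cross
   coefficient [b] is shared by [p] and [q]. *)
Definition closed_at (x y a b c : R) : Prop :=
  forall e : R, 0 < e -> exists2 d : R, 0 < d & forall s t : R, `|s| < d -> `|t| < d ->
    `|p (x + s) (y + t) - (p x y + a * s + b * t)| <= e * (`|s| + `|t|) /\
    `|q (x + s) (y + t) - (q x y + b * s + c * t)| <= e * (`|s| + `|t|).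

Hypothesis pc : forall y, continuous (p^~ y).
Hypothesis qc : forall x, continuous (q x).

Let P x y := prim (- r) (p^~ y) x.
Let Q x y := prim (- r) (q x) y.
Let S x y := P x y - Q x y.

(** The affine part of the form has a zero integral along the boundary of the rectangle, because [b]
    is shared by both components. Only the remainder is left: small against the size, and integrated
    over sides of that size. *)
Lemma closed_at_mixed_diff x y a b c : closed_at x y a b c ->
  forall e : R, 0 < e -> exists2 dl : R, 0 < dl &
    forall a' b' c' d' : R, - r < a' <= x -> x <= b' -> - r < c' <= y -> y <= d' ->
      (b' - a') + (d' - c') < dl ->
      `|mixed_diff S (a', b', c', d')| <= e * ((b' - a') + (d' - c')) ^+ 2.
Proof.
move=> cl e e0; have e20 : 0 < e / 2 by rewrite divr_gt0.
have [d d0 Hd] := cl _ e20; exists d => // a' b' c' d'.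
move=> /andP[ra ax] xb /andP[rc cy] yd len.
set L := (b' - a') + (d' - c') in len *.
(* Each component is recentred so as to be affine in the variable that moves along a side. Opposite
   sides count twice, which uses up the factor [1 / 2]. *)
have bnd s t : a' <= s <= b' -> c' <= t <= d' ->
    `|p s t - ((p x y - a * x + b * (t - y)) + a * s)| <= e / 2 * L /\
    `|q s t - ((q x y - c * y + b * (s - x)) + c * t)| <= e / 2 * L.
  move=> /andP[? ?] /andP[? ?].
  have sd : `|s - x| <= b' - a' by rewrite ler_norml; apply/andP; split; lra.
  have td : `|t - y| <= d' - c' by rewrite ler_norml; apply/andP; split; lra.
  have [||] := Hd (s - x) (t - y).
  - by apply: le_lt_trans sd _; rewrite /L in len; lra.
  - by apply: le_lt_trans td _; rewrite /L in len; lra.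
  rewrite !subrKC => h1 h2.
  have lel : e / 2 * (`|s - x| + `|t - y|) <= e / 2 * L.
    by apply: ler_wpM2l; [exact: ltW | exact: lerD].
  split; [apply: le_trans lel; apply: le_trans h1|apply: le_trans lel; apply: le_trans h2];
    by rewrite le_eqVlt; apply/orP; left; apply/eqP; congr (`| _ |); ring.
have aa : a' <= a' <= b' by rewrite lexx; lra.
have bb : a' <= b' <= b' by rewrite lexx andbT; lra.
have cc : c' <= c' <= d' by rewrite lexx; lra.
have dd : c' <= d' <= d' by rewrite lexx andbT; lra.
have ab : a' <= b' by lra.
have cd : c' <= d' by lra.
have p1 := prim_diff_approx (@pc c') ra ab (fun s hs => (bnd s c' hs cc).1).
have p2 := prim_diff_approx (@pc d') ra ab (fun s hs => (bnd s d' hs dd).1).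
have q1 := prim_diff_approx (@qc a') rc cd (fun s hs => (bnd a' s aa hs).2).
have q2 := prim_diff_approx (@qc b') rc cd (fun s hs => (bnd b' s bb hs).2).
set X1 := (X in `|X| <= _) in p1; set X2 := (X in `|X| <= _) in p2.
set Y1 := (X in `|X| <= _) in q1; set Y2 := (X in `|X| <= _) in q2.
have -> : mixed_diff S (a', b', c', d') = X2 - X1 - (Y2 - Y1).
  by rewrite /mixed_diff /X1 /X2 /Y1 /Y2 /S /P /Q; field.
apply: le_trans (ler_normB _ _) _.
apply: le_trans (lerD (ler_normB _ _) (ler_normB _ _)) _.
apply: le_trans (lerD (lerD p2 p1) (lerD q2 q1)) _.
rewrite le_eqVlt; apply/orP; left; apply/eqP; by rewrite /L; field.
Qed.

Hypothesis clq : forall x y, `|x| < r -> `|y| < r -> exists a b c, closed_at x y a b c.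

Lemma mixed_diff_rect0 a b c d : - r < a -> a <= b -> b < r -> - r < c -> c <= d -> d < r ->
  mixed_diff S (a, b, c, d) = 0.
Proof.
move=> ra ab br rc cd dr; apply: mixed_diff_eq0 => // x y /andP[ax xb] /andP[cy yd] e e0.
have xr : `|x| < r by rewrite ltr_norml; apply/andP; split; lra.
have yr : `|y| < r by rewrite ltr_norml; apply/andP; split; lra.
have [a1 [b1 [c1 cl]]] := clq xr yr.
have [dl dl0 H] := closed_at_mixed_diff cl e0; exists dl => // a' b' c' d'.
move=> /andP[? ?] /andP[? ?] /andP[? ?] /andP[? ?].
by apply: H => //; apply/andP; split => //; lra.
Qed.

(** Horizontal increments of [S] are the same at all heights. This is what makes integration along a
    broken line independent of the line. *)
Lemma mixed_diff_eq x x' y y' : `|x| < r -> `|x'| < r -> `|y| < r -> `|y'| < r ->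
  S x' y' - S x y' = S x' y - S x y.
Proof.
move=> xr x'r yr y'r.
wlog xx : x x' xr x'r / x <= x' => [H|].
  have [h|/ltW h] := leP x x'; first exact: H.
  by have := H _ _ x'r xr h; lra.
wlog yy : y y' yr y'r / y <= y' => [H|].
  have [?|/ltW ?] := leP y y'; first exact: H.
  by symmetry; apply: H.
move: xr x'r yr y'r => /ltr_normlP[? ?] /ltr_normlP[? ?] /ltr_normlP[? ?] /ltr_normlP[? ?].
have := @mixed_diff_rect0 x x' y y' ltac:(lra) xx ltac:(lra) ltac:(lra) yy ltac:(lra).
rewrite /mixed_diff => E.
by apply/eqP; rewrite -subr_eq0 -E; apply/eqP; ring.
Qed.

End ClosedForm.

Lemma prim_diff_approx2 (R : realType) (A0 : R) (k : R -> R) (al be m x s : R) :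
  continuous k -> A0 < x -> A0 < x + s -> 0 <= m ->
  (forall t, `|t| <= `|s| -> `|k (x + t) - (al + be * t)| <= m) ->
  `|prim A0 k (x + s) - prim A0 k x - (al * s + be * s ^+ 2 / 2)| <= m * `|s|.
Proof.
move=> kc Ax As m0 H.
have H' t : `|t - x| <= `|s| -> `|k t - ((al - be * x) + be * t)| <= m.
  move=> /H; rewrite subrKC => h; apply: le_trans h.
  by rewrite le_eqVlt; apply/orP; left; apply/eqP; congr (`| _ |); ring.
have [s0|s0] := leP 0 s.
  have := @prim_diff_approx _ A0 k (al - be * x) be m x (x + s) kc Ax ltac:(lra).
  rewrite (ger0_norm s0) => H1.
  have -> : al * s + be * s ^+ 2 / 2 = (al - be * x) * (x + s - x) + be * ((x + s) ^+ 2 - x ^+ 2) / 2 by field.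
  have -> : m * s = m * (x + s - x) by ring.
  apply: H1 => t /andP[? ?]; apply: H'; rewrite (ger0_norm s0).
  by rewrite ler_norml; apply/andP; split; lra.
have := @prim_diff_approx _ A0 k (al - be * x) be m (x + s) x kc As ltac:(lra).
rewrite (ltr0_norm s0) => H1.
have -> : m * - s = m * (x - (x + s)) by ring.
rewrite -normrN; apply: le_trans (H1 _).
  by rewrite le_eqVlt; apply/orP; left; apply/eqP; congr (`| _ |); field.
move=> t /andP[? ?]; apply: H'; rewrite (ltr0_norm s0).
by rewrite ler_norml; apply/andP; split; lra.
Qed.

(** A horizontal increment of [F] is computed on the axis, then moved to height [y] by
    [mixed_diff_eq], where it becomes an increment of [P] plus one of [Q]. Integrating the
    first-order expansions of [p] and [q] yields the second-order expansion of [F]. *)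
Lemma closed_form_primitive (R : realType) (r : R) (p q : R -> R -> R) :
  0 < r -> (forall y, continuous (p^~ y)) -> (forall x, continuous (q x)) ->
  (forall x y, `|x| < r -> `|y| < r -> exists a b c, closed_at p q x y a b c) ->
  exists F : R -> R -> R, forall x y a b c, `|x| < r -> `|y| < r ->
    closed_at p q x y a b c ->
    forall e : R, 0 < e -> exists2 d : R, 0 < d & forall s t : R, `|s| < d -> `|t| < d ->
    `|F (x + s) (y + t) - F x y - (p x y * s + q x y * t + a * s ^+ 2 / 2 + b * s * t + c * t ^+ 2 / 2)|
      <= e * (`|s| + `|t|) ^+ 2.
Proof.
move=> r0 pc qc cl.
pose P x y := prim (- r) (p^~ y) x.
pose Q x y := prim (- r) (q x) y.
pose S x y := P x y - Q x y.
(* This is [P x 0 + (Q x y - Q x 0)]: along the axis to [x], then vertically to [y]. *)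
exists (fun x y => Q x y + S x 0) => x y a b c xr yr clxy e e0.
have [d d0 H] := clxy e e0.
move: (xr) (yr) => /ltr_normlP[x1 x2] /ltr_normlP[y1 y2].
pose d' := Num.min d (Num.min (r - `|x|) (r - `|y|)).
exists d'; first by rewrite !lt_min d0 !subr_gt0 xr yr.
move=> s t; rewrite !lt_min => /and3P[sd sx sy] /and3P[td tx ty].
have xsr : `|x + s| < r by apply: le_lt_trans (ler_normD _ _) _; lra.
have ytr : `|y + t| < r by apply: le_lt_trans (ler_normD _ _) _; lra.
have r00 : `|0 : R| < r by rewrite normr0.
have E : S (x + s) 0 - S x 0 = S (x + s) y - S x y.
  exact: (mixed_diff_eq pc qc cl).
have Pb : `|P (x + s) y - P x y - (p x y * s + a * s ^+ 2 / 2)| <= (e * `|s|) * `|s|.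
  move: (xsr) => /ltr_normlP[xs1 xs2].
  apply: prim_diff_approx2; [exact: pc|lra|lra|by rewrite mulr_ge0 // ltW|].
  move=> u us; have [] := H u 0 (le_lt_trans us sd); first by rewrite normr0.
  rewrite addr0 normr0 addr0 mulr0 addr0 => h _; apply: le_trans h _.
  by rewrite ler_pM2l.
have Qb : `|Q (x + s) (y + t) - Q (x + s) y - ((q x y + b * s) * t + c * t ^+ 2 / 2)| <= (e * (`|s| + `|t|)) * `|t|.
  move: (ytr) => /ltr_normlP[yt1 yt2].
  apply: prim_diff_approx2; [exact: qc|lra|lra|by rewrite mulr_ge0 ?addr_ge0 // ltW|].
  move=> u ut; have [_ h] := H s u sd (le_lt_trans ut td).
  by apply: le_trans h _; rewrite ler_pM2l // lerD2l.
have -> : Q (x + s) (y + t) + S (x + s) 0 - (Q x y + S x 0) -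
   (p x y * s + q x y * t + a * s ^+ 2 / 2 + b * s * t + c * t ^+ 2 / 2) =
   (P (x + s) y - P x y - (p x y * s + a * s ^+ 2 / 2)) +
   (Q (x + s) (y + t) - Q (x + s) y - ((q x y + b * s) * t + c * t ^+ 2 / 2)).
  have -> : S (x + s) 0 = S x 0 + (S (x + s) y - S x y) by rewrite -E; ring.
  by rewrite /S; field.
apply: le_trans (ler_normD _ _) _; apply: le_trans (lerD Pb Qb) _.
have := normr_ge0 s; have := normr_ge0 t; move: (`|s|) (`|t|) => u v v0 u0.
have : 0 <= e * (u * v) by rewrite !mulr_ge0 // ltW.
rewrite expr2; nra.
Qed.

(** * Second order expansions and the maximum principle *)

Section L1.
Variable R : realType.
Local Notation C := R[i].
Implicit Types z w : C.

Lemma complex_ReD z w : Re (z + w) = Re z + Re w. Proof. by case: z => ? ?; case: w. Qed.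
Lemma complex_ImD z w : Im (z + w) = Im z + Im w. Proof. by case: z => ? ?; case: w. Qed.
Lemma complex_ReN z : Re (- z) = - Re z. Proof. by case: z. Qed.
Lemma complex_ImN z : Im (- z) = - Im z. Proof. by case: z. Qed.
Lemma complex_ReM z w : Re (z * w) = Re z * Re w - Im z * Im w. Proof. by case: z => ? ?; case: w. Qed.
Lemma complex_ImM z w : Im (z * w) = Re z * Im w + Im z * Re w. Proof. by case: z => ? ?; case: w. Qed.
Definition ReImE := (complex_ReD, complex_ImD, complex_ReN, complex_ImN, complex_ReM, complex_ImM).

Lemma complex_eqP z w : Re z = Re w -> Im z = Im w -> z = w.
Proof. by case: z => ? ?; case: w => ? ? /= -> ->. Qed.

(** A real-valued norm within reach of [lra], whereas the modulus of [R[i]] is itself a complex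
    number. It is only submultiplicative, which is the origin of the factor 2 in [l1V] and of the
    radii that follow from it. *)
Definition l1 z : R := `|Re z| + `|Im z|.

Lemma l1_ge0 z : 0 <= l1 z. Proof. by rewrite addr_ge0. Qed.
Lemma l1N z : l1 (- z) = l1 z. Proof. by rewrite /l1 complex_ReN complex_ImN !normrN. Qed.
Lemma l10 : l1 0 = 0. Proof. by rewrite /l1 /= normr0 addr0. Qed.
Lemma l1_eq0 z : (l1 z == 0) = (z == 0).
Proof. by rewrite paddr_eq0 // !normr_eq0 eq_complex. Qed.
Lemma l1_gt0 z : z != 0 -> 0 < l1 z.
Proof. by move=> z0; rewrite lt_neqAle l1_ge0 eq_sym l1_eq0 z0. Qed.
Lemma ler_l1D z w : l1 (z + w) <= l1 z + l1 w.
Proof.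
rewrite /l1 complex_ReD complex_ImD; have := ler_normD (Re z) (Re w); have := ler_normD (Im z) (Im w).
lra.
Qed.
Lemma ler_l1B z w : l1 (z - w) <= l1 z + l1 w.
Proof. by rewrite -(l1N w); exact: ler_l1D. Qed.
Lemma ler_l1M z w : l1 (z * w) <= l1 z * l1 w.
Proof.
rewrite /l1 complex_ReM complex_ImM.
have := ler_normB (Re z * Re w) (Im z * Im w).
have := ler_normD (Re z * Im w) (Im z * Re w).
rewrite !normrM; lra.
Qed.
Lemma ler_l1X z n : l1 (z ^+ n) <= l1 z ^+ n.
Proof.
elim: n => [|n IH]; first by rewrite !expr0 /l1 /= normr1 normr0 addr0.
rewrite !exprS; apply: le_trans (ler_l1M _ _) _.
by apply: ler_wpM2l IH; exact: l1_ge0.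
Qed.
Lemma ler_Re_l1 z : `|Re z| <= l1 z. Proof. by rewrite lerDl. Qed.
Lemma ler_Im_l1 z : `|Im z| <= l1 z. Proof. by rewrite lerDr. Qed.

Lemma l1V z : l1 z^-1 <= 2 / l1 z.
Proof.
have [->|z0] := eqVneq z 0; first by rewrite invr0 l10 invr0 mulr0.
have l0 := l1_gt0 z0.
rewrite ler_pdivlMr //.
case: z z0 l0 => a b z0 l0; rewrite /l1 /= normrN !normrM -mulrDl.
have E : 0 < a ^+ 2 + b ^+ 2.
  have := z0; rewrite eq_complex /= negb_and => /orP[h|h].
    by rewrite ltr_wpDr ?sqr_ge0 // lt_neqAle sqr_ge0 andbT eq_sym sqrf_eq0.
  by rewrite ltr_wpDl ?sqr_ge0 // lt_neqAle sqr_ge0 andbT eq_sym sqrf_eq0.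
rewrite mulrAC normfV (gtr0_norm E) ler_pdivrMr //.
rewrite -(real_normK (num_real a)) -(real_normK (num_real b)).
by have := sqr_ge0 (`|a| - `|b|); lra.
Qed.

End L1.

(** * Second-order expansions at a point *)

Section Taylor2.
Variable R : realType.
Local Notation C := R[i].
Implicit Types (z w A B : C) (h g : C -> C).

Definition cderiv g z A := forall e : R, 0 < e -> exists2 d : R, 0 < d &
  forall w, l1 w < d -> l1 (g (z + w) - g z - A * w) <= e * l1 w.

(** [B] stands for half the second derivative. The expansion is pointwise: no continuity of
    derivatives is implied. *)
Definition taylor2 h z A B := forall e : R, 0 < e -> exists2 d : R, 0 < d &
  forall w, l1 w < d -> l1 (h (z + w) - h z - A * w - B * w ^+ 2) <= e * l1 w ^+ 2.

Lemma taylor2M h1 h2 z A1 B1 A2 B2 : taylor2 h1 z A1 B1 -> taylor2 h2 z A2 B2 ->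
  taylor2 (fun u => h1 u * h2 u) z (A1 * h2 z + h1 z * A2) (B1 * h2 z + A1 * A2 + h1 z * B2).
Proof.
move=> t1 t2 e e0.
(* [K1] and [K2] bound the two quadratic polynomials for [l1 w <= 1]; [c] below bounds the terms of
   degree 3 and 4 of their product. *)
pose K1 := l1 (h1 z) + l1 A1 + l1 B1; pose K2 := l1 (h2 z) + l1 A2 + l1 B2.
have K10 : 0 <= K1 by rewrite !addr_ge0 ?l1_ge0.
have K20 : 0 <= K2 by rewrite !addr_ge0 ?l1_ge0.
pose c := l1 (A1 * B2 + B1 * A2) + l1 (B1 * B2).
have c0 : 0 <= c by rewrite addr_ge0 ?l1_ge0.
pose e1 := Num.min 1 (e / (2 * (K1 + K2 + 1))).
have S0 : 0 < 2 * (K1 + K2 + 1) by lra.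
have e10 : 0 < e1 by rewrite lt_min ltr01 divr_gt0.
have e1le : e1 * (K1 + K2 + 1) <= e / 2.
  have : e1 <= e / (2 * (K1 + K2 + 1)) by rewrite /e1 ge_min lexx orbT.
  by rewrite ler_pdivlMr //; lra.
have e11 : e1 <= 1 by rewrite /e1 ge_min lexx.
have [d1 d10 H1] := t1 _ e10; have [d2 d20 H2] := t2 _ e10.
exists (Num.min (Num.min d1 d2) (Num.min 1 (e / (2 * (c + 1))))).
  by rewrite !lt_min d10 d20 ltr01 divr_gt0 //; lra.
move=> w; rewrite !lt_min => /andP[/andP[wd1 wd2] /andP[w1 wc]].
have := H1 w wd1; have := H2 w wd2.
set r1 := h1 (z + w) - _ - _ - _; set r2 := h2 (z + w) - _ - _ - _ => R2 R1.
pose P1 := h1 z + A1 * w + B1 * w ^+ 2; pose P2 := h2 z + A2 * w + B2 * w ^+ 2.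
set n := l1 w in wd1 wd2 w1 wc R1 R2 *.
have n0 : 0 <= n by exact: l1_ge0.
have n2 : 0 <= n ^+ 2 by exact: sqr_ge0.
have Pb (A B D : C) : l1 (D + A * w + B * w ^+ 2) <= l1 D + l1 A + l1 B.
  apply: le_trans (ler_l1D _ _) _; apply: lerD.
    apply: le_trans (ler_l1D _ _) _; apply: lerD => //.
    apply: le_trans (ler_l1M _ _) _; rewrite ler_piMr ?l1_ge0 //; exact: ltW.
  apply: le_trans (ler_l1M _ _) _; rewrite ler_piMr ?l1_ge0 //.
  by apply: le_trans (ler_l1X _ _) _; rewrite exprn_ile1 // ltW.
have PB1 : l1 P1 <= K1 by exact: Pb.
have PB2 : l1 P2 <= K2 by exact: Pb.
have -> : h1 (z + w) * h2 (z + w) - h1 z * h2 z - (A1 * h2 z + h1 z * A2) * w -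
     (B1 * h2 z + A1 * A2 + h1 z * B2) * w ^+ 2 =
   (r1 * P2 + P1 * r2 + r1 * r2) + ((A1 * B2 + B1 * A2) * (w ^+ 2 * w) + B1 * B2 * (w ^+ 2 * (w * w))).
  by rewrite /r1 /r2 /P1 /P2; ring.
have part2 : l1 ((A1 * B2 + B1 * A2) * (w ^+ 2 * w) + B1 * B2 * (w ^+ 2 * (w * w))) <= c * n * n ^+ 2.
  have w3 : l1 (w ^+ 2 * w) <= n * n ^+ 2.
    apply: le_trans (ler_l1M _ _) _; rewrite mulrC; apply: ler_wpM2l => //; exact: ler_l1X.
  have w4 : l1 (w ^+ 2 * (w * w)) <= n * n ^+ 2.
    apply: le_trans (ler_l1M _ _) _; rewrite mulrC.
    apply: ler_pM; [exact: l1_ge0|exact: l1_ge0| |exact: ler_l1X].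
    apply: le_trans (ler_l1M _ _) _; rewrite -[leRHS]mulr1; apply: ler_pM => //; exact: ltW.
  have -> : c * n * n ^+ 2 = l1 (A1 * B2 + B1 * A2) * (n * n ^+ 2) + l1 (B1 * B2) * (n * n ^+ 2).
    by rewrite /c; ring.
  apply: le_trans (ler_l1D _ _) _; apply: lerD.
    by apply: le_trans (ler_l1M _ _) _; apply: ler_wpM2l w3; exact: l1_ge0.
  by apply: le_trans (ler_l1M _ _) _; apply: ler_wpM2l w4; exact: l1_ge0.
have b1 : l1 (r1 * P2) <= e1 * n ^+ 2 * K2.
  apply: le_trans (ler_l1M _ _) _; apply: ler_pM => //; exact: l1_ge0.
have b2 : l1 (P1 * r2) <= K1 * (e1 * n ^+ 2).
  apply: le_trans (ler_l1M _ _) _; apply: ler_pM => //; exact: l1_ge0.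
have b3 : l1 (r1 * r2) <= e1 * n ^+ 2.
  apply: le_trans (ler_l1M _ _) _; rewrite -[leRHS]mulr1; apply: ler_pM => //; try exact: l1_ge0.
  apply: le_trans R2 _; rewrite -[leRHS]mulr1; apply: ler_pM => //; first exact: ltW.
  by rewrite exprn_ile1 // ltW.
have cn : c * n <= e / 2.
  have : n * (c + 1) <= e / 2.
    have := ltW wc; rewrite -ler_pdivlMr; last by lra.
    by move=> h; apply: le_trans h _; rewrite invfM mulrA.
  by lra.
apply: le_trans (ler_l1D _ _) _.
have := ler_l1D (r1 * P2 + P1 * r2) (r1 * r2); have := ler_l1D (r1 * P2) (P1 * r2).
have : c * n * n ^+ 2 <= e / 2 * n ^+ 2 by apply: ler_wpM2r.
have : e1 * (K1 + K2 + 1) * n ^+ 2 <= e / 2 * n ^+ 2 by apply: ler_wpM2r.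
lra.
Qed.

(** The remainder is exactly [- w ^+ 3 / (z ^+ 3 * (z + w))], and [z + w] stays away from 0 once
    [l1 w < l1 z / 2]. *)
Lemma taylor2V z : z != 0 -> taylor2 (fun u => u^-1) z (- z^-1 ^+ 2) (z^-1 ^+ 3).
Proof.
move=> z0 e e0; have lz := l1_gt0 z0.
pose K := l1 (z^-1 ^+ 3) * (4 / l1 z).
have K0 : 0 <= K by rewrite mulr_ge0 ?l1_ge0 // divr_ge0 // ltW.
exists (Num.min (l1 z / 2) (e / (K + 1))).
  by rewrite lt_min !divr_gt0 //; lra.
move=> w; rewrite lt_min => /andP[w1 w2].
have zw : l1 z / 2 <= l1 (z + w).
  have : l1 z <= l1 (z + w) + l1 w.
    by rewrite {1}(_ : z = z + w - w) ?ler_l1B //; ring.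
  by lra.
have zw0 : z + w != 0 by rewrite -l1_eq0; apply/eqP => E; rewrite E in zw; lra.
have -> : (z + w)^-1 - z^-1 - - z^-1 ^+ 2 * w - z^-1 ^+ 3 * w ^+ 2 =
   - (z^-1 ^+ 3 * (z + w)^-1 * w * w ^+ 2).
  by field; rewrite z0 zw0.
rewrite l1N; apply: le_trans (ler_l1M _ _) _.
apply: ler_pM; [exact: l1_ge0|exact: l1_ge0| |exact: ler_l1X].
apply: (@le_trans _ _ (K * l1 w)).
  apply: le_trans (ler_l1M _ _) _; apply: ler_wpM2r; first exact: l1_ge0.
  apply: le_trans (ler_l1M _ _) _; apply: ler_wpM2l; first exact: l1_ge0.
  apply: le_trans (l1V _) _; rewrite ler_pdivrMr; last by lra.
  rewrite mulrAC ler_pdivlMr //; lra.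
have : l1 w * (K + 1) < e by rewrite -ltr_pdivlMr //; lra.
by have := l1_ge0 w; lra.
Qed.

Definition twice_diff h z := exists A B, taylor2 h z A B.

Lemma twice_diffM h1 h2 z : twice_diff h1 z -> twice_diff h2 z ->
  twice_diff (fun u => h1 u * h2 u) z.
Proof. by move=> [? [? h]] [? [? h']]; do 2!eexists; exact: taylor2M h h'. Qed.

Lemma twice_diff_cst c z : twice_diff (fun=> c) z.
Proof.
exists 0, 0 => e e0; exists 1 => // w _.
by rewrite !mul0r subrr !subr0 l10 mulr_ge0 ?sqr_ge0 // ltW.
Qed.

Lemma twice_diffX h n z : twice_diff h z -> twice_diff (fun u => h u ^+ n) z.
Proof.
move=> hz; elim: n => [|n IH]; first by exact: twice_diff_cst.
rewrite (_ : (fun _ => _) = (fun u => h u * h u ^+ n)); last first.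
  by apply/funext => u; rewrite exprS.
exact: twice_diffM.
Qed.

Lemma twice_diff0 h z (d : R) : 0 < d -> (forall w, l1 w < d -> h (z + w) = 0) -> twice_diff h z.
Proof.
move=> d0 H; exists 0, 0 => e e0; exists d => // w wd.
have -> : h z = 0 by rewrite -[z]addr0 H // l10.
by rewrite H // !mul0r !subr0 l10 mulr_ge0 ?sqr_ge0 // ltW.
Qed.

Lemma twice_diff_continuous h z (e : R) : twice_diff h z -> 0 < e ->
  exists2 d : R, 0 < d & forall w, l1 w < d -> l1 (h (z + w) - h z) < e.
Proof.
move=> [A [B H]] e0; have [d d0 {}H] := H 1 ltr01.
pose K := l1 A + l1 B + 1.
have K0 : 0 < K by rewrite ltr_wpDl ?addr_ge0 ?l1_ge0.
exists (Num.min d (Num.min 1 (e / K))); first by rewrite !lt_min d0 ltr01 divr_gt0.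
move=> w; rewrite !lt_min => /and3P[wd w1 we].
rewrite (_ : h (z + w) - h z = (h (z + w) - h z - A * w - B * w ^+ 2) + (A * w + B * w ^+ 2)); last by ring.
have w0 := l1_ge0 w.
have ww : l1 w ^+ 2 <= l1 w by rewrite expr2 ler_piMr // ltW.
have := H _ wd; rewrite mul1r => h1.
have h2 := ler_l1M A w.
have h3 : l1 (B * w ^+ 2) <= l1 B * l1 w.
  apply: le_trans (ler_l1M _ _) _; apply: ler_wpM2l; first exact: l1_ge0.
  exact: le_trans (ler_l1X _ _) ww.
have h4 : l1 w * K < e by rewrite -ltr_pdivlMr.
apply: le_lt_trans (ler_l1D _ _) _; have := ler_l1D (A * w) (B * w ^+ 2).
by rewrite /K in h4; lra.
Qed.

(* The directions t, -t, it, -it have vanishing sums of first and second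
   powers, so the symmetric second difference of [h] is o(t^2). *)
Lemma twice_diff_harmonic h z (e : R) : twice_diff h z -> 0 < e ->
  exists2 d : R, 0 < d & forall t : R, 0 < t < d ->
   - e * t ^+ 2 <= Re (h (z + t%:C)) + Re (h (z - t%:C)) + Re (h (z + 'i * t%:C))
     + Re (h (z - 'i * t%:C)) - 4 * Re (h z).
Proof.
move=> [A [B H]] e0; have [d d0 {}H] := H (e / 4) ltac:(lra).
exists d => // t /andP[t0 td].
have lt w : l1 w = t -> - (e / 4) * t ^+ 2 <= Re (h (z + w) - h z - A * w - B * w ^+ 2).
  move=> wt; have := H w; rewrite wt => /(_ td) h1.
  have := le_trans (ler_Re_l1 _) h1; rewrite ler_norml => /andP[].
  by rewrite mulNr.
have l1t : l1 t%:C = t by rewrite /l1 /= normr0 addr0 gtr0_norm.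
have l1it : l1 ('i * t%:C) = t.
  by rewrite /l1 /= !mul0r !mul1r subr0 add0r normr0 add0r gtr0_norm.
have := lt _ l1t; have := lt (- t%:C); rewrite l1N => /(_ l1t).
have := lt _ l1it; have := lt (- ('i * t%:C)); rewrite l1N => /(_ l1it).
rewrite !expr2 !ReImE /=.
lra.
Qed.

End Taylor2.

Lemma is_derive0_eps (R : realType) (f : R -> R) (t : R) :
  (forall e : R, 0 < e -> exists2 d : R, 0 < d & forall s, `|s| < d -> `|f (t + s) - f t| <= e * `|s|) ->
  is_derive t 1 f 0.
Proof.
move=> H.
have cv : (fun h : R => h^-1 *: (f (h *: (1 : R) + t) - f t)) @ 0^' --> (0 : R).
  apply/cvgrPdist_le => e e0; have [d d0 {}H] := H e e0.
  near=> h.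
  have h0 : h != 0 by near: h; exact: nbhs_dnbhs_neq.
  have hd : `|h| < d by near: h; exact: dnbhs0_lt.
  rewrite sub0r normrN normrZ normfV ler_pdivrMl ?normr_gt0 // mulrC.
  by rewrite (addrC (h *: 1)) /GRing.scale /= mulr1; exact: H.
by apply: DeriveDef; [apply/cvg_ex; exists 0|apply: cvg_lim].
Unshelve. all: by end_near. Qed.

Lemma continuous_eps (R : realType) (f : R -> R) :
  (forall x (e : R), 0 < e -> exists2 d : R, 0 < d & forall x', `|x' - x| < d -> `|f x' - f x| < e) ->
  continuous f.
Proof.
move=> H x; apply/cvgrPdist_lt => e e0; have [d d0 {}H] := H x e e0.
by near=> x'; rewrite distrC; apply: H; rewrite distrC; near: x'; exact: cvgr_dist_lt.
Unshelve. all: by end_near. Qed.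

Lemma square_max (R : realType) (U : R -> R -> R) (s : R) : 0 <= s ->
  (forall x y, `|x| <= s -> `|y| <= s -> forall e : R, 0 < e -> exists2 d : R, 0 < d &
    forall a b : R, `|a| < d -> `|b| < d -> `|U (x + a) (y + b) - U x y| < e) ->
  exists x0 y0, [/\ `|x0| <= s, `|y0| <= s &
    forall x y, `|x| <= s -> `|y| <= s -> U x y <= U x0 y0].
Proof.
move=> s0 cU.
pose A : set (R * R) := `[-s, s] `*` `[-s, s].
have AE x : (`[-s, s]%classic : set R) x <-> `|x| <= s.
  by rewrite /= in_itv /= ler_norml.
have A0 : A !=set0 by exists (0, 0); split; apply/AE; rewrite normr0.
have Ac : compact A by apply: compact_setX; exact: segment_compact.
pose f (z : R * R) := U z.1 z.2.
have cf : {within A, continuous f}.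
  apply: continuous_in_subspaceT => -[x y]; rewrite inE => -[/AE /= xs /AE /= ys].
  apply/cvgrPdist_lt => e e0; have [d d0 H] := cU x y xs ys e e0.
  exists (ball x d, ball y d) => /=; first by split; exact: nbhsx_ballx.
  move=> [x' y'] [/= hx hy].
  rewrite distrC -[x'](subrKC x) -[y'](subrKC y); apply: H; rewrite distrC //.
have [[x0 y0]] := compact_EVT_max A0 Ac cf.
rewrite inE => -[/AE /= xs /AE /= ys] H; exists x0, y0; split => // x y hx hy.
by apply: (H (x, y)); rewrite inE; split; apply/AE.
Qed.

Section Holomorphic1.
Variable R : realType.
Local Notation C := R[i].
Implicit Types (z w A B : C) (h g : C -> C).

Lemma cderiv_continuous g z A (e : R) : cderiv g z A -> 0 < e ->
  exists2 d : R, 0 < d & forall w, l1 w < d -> l1 (g (z + w) - g z) < e.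
Proof.
move=> H e0; have [d d0 {}H] := H 1 ltr01.
pose K := l1 A + 1.
have K0 : 0 < K by rewrite ltr_wpDl ?l1_ge0.
exists (Num.min d (e / K)); first by rewrite lt_min d0 divr_gt0.
move=> w; rewrite lt_min => /andP[wd we].
rewrite (_ : g (z + w) - g z = (g (z + w) - g z - A * w) + A * w); last by ring.
have := H _ wd; rewrite mul1r => h1.
have h2 := ler_l1M A w.
have h4 : l1 w * K < e by rewrite -ltr_pdivlMr.
by apply: le_lt_trans (ler_l1D _ _) _; rewrite /K in h4; lra.
Qed.

(** The form [g dz] is the pair of real forms [Re g dx - Im g dy] and [Im g dx + Re g dy], both
    closed by the Cauchy-Riemann equations contained in [cderiv]. Halving the square leaves room for
    the clamped arguments. *)
Lemma complex_primitive g (r : R) : 0 < r ->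
  (forall z, `|Re z| < r -> `|Im z| < r -> exists A, cderiv g z A) ->
  exists H, forall z, `|Re z| < r / 2 -> `|Im z| < r / 2 -> exists B, taylor2 H z (g z) B.
Proof.
move=> r0 gd; set q := r / 2; have q0 : 0 < q by rewrite divr_gt0.
have qr : q < r by rewrite /q; lra.
(* Clamping makes the coefficients of the forms continuous on the whole plane. *)
pose cl (x : R) : R := if x <= - q then - q else if q <= x then q else x.
have cl_bd (x : R) : `|cl x| <= q.
  rewrite /cl ler_norml; case: (leP x (- q)) => ?; [|case: (leP q x) => ?]; apply/andP; split; lra.
have cl_id (x : R) : `|x| <= q -> cl x = x.
  rewrite ler_norml => /andP[? ?]; rewrite /cl; case: (leP x (- q)) => ?; [|case: (leP q x) => ?]; lra.
have cl_lip (x y : R) : `|cl x - cl y| <= `|x - y|.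
  have := ler_norm (x - y); have := ler_norm (y - x); rewrite (distrC y x) => ? ?.
  rewrite /cl; case: (leP x (- q)) => ?; [|case: (leP q x) => ?];
  (case: (leP y (- q)) => ?; [|case: (leP q y) => ?]); rewrite ler_norml; apply/andP; split; lra.
pose G (x y : R) := g (cl x +i* cl y).
have Gc (x y e : R) : 0 < e -> exists2 d : R, 0 < d &
    forall x' y' : R, `|x' - x| + `|y' - y| < d -> l1 (G x' y' - G x y) < e.
  move=> e0; have [||A hA] := gd (cl x +i* cl y).
  - exact: le_lt_trans (cl_bd _) qr.
  - exact: le_lt_trans (cl_bd _) qr.
  have [d d0 H] := cderiv_continuous hA e0; exists d => // x' y' hd.
  rewrite /G (_ : cl x' +i* cl y' = cl x +i* cl y + ((cl x' - cl x) +i* (cl y' - cl y))); last first.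
    by apply: complex_eqP; rewrite ReImE /=; ring.
  apply: H; apply: le_lt_trans hd; by apply: lerD; exact: cl_lip.
have sub_bd (f : C -> R) (f1 : forall w, `|f w| <= l1 w) (fB : forall z w, f (z - w) = f z - f w) :
    (forall y, continuous (fun x => f (G x y))) /\ (forall x, continuous (fun y => f (G x y))).
  split=> [y|x]; apply: continuous_eps => t e e0.
    have [d d0 H] := Gc t y e e0; exists d => // t' td.
    by rewrite -fB; apply: le_lt_trans (f1 _) _; apply: H; rewrite subrr normr0 addr0.
  have [d d0 H] := Gc x t e e0; exists d => // t' td.
  by rewrite -fB; apply: le_lt_trans (f1 _) _; apply: H; rewrite subrr normr0 add0r.
have [Rx Ry] := sub_bd (@complex.Re R) (@ler_Re_l1 R) (fun z w => etrans (complex_ReD _ _) (congr1 _ (complex_ReN _))).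
have [Ix Iy] := sub_bd (@complex.Im R) (@ler_Im_l1 R) (fun z w => etrans (complex_ImD _ _) (congr1 _ (complex_ImN _))).
have nIy x : continuous (fun y => - Im (G x y)).
  by move=> y; apply: continuousN; exact: Iy.
have dG (x y : R) A : `|x| < q -> `|y| < q -> cderiv g (x +i* y) A ->
  forall e : R, 0 < e -> exists2 d : R, 0 < d & forall s t : R, `|s| < d -> `|t| < d ->
    l1 (G (x + s) (y + t) - G x y - A * (s +i* t)) <= e * (`|s| + `|t|).
  move=> xq yq hA e e0; have [d d0 H] := hA e e0.
  exists (Num.min (d / 2) (Num.min (q - `|x|) (q - `|y|))).
    by rewrite !lt_min divr_gt0 //= !subr_gt0 xq yq.
  move=> s t; rewrite !lt_min => /and3P[sd sx _] /and3P[td _ ty].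
  have hx : `|x + s| <= q by apply: le_trans (ler_normD _ _) _; lra.
  have hy : `|y + t| <= q by apply: le_trans (ler_normD _ _) _; lra.
  rewrite /G (cl_id _ hx) (cl_id _ hy) (cl_id _ (ltW xq)) (cl_id _ (ltW yq)).
  rewrite (_ : (x + s) +i* (y + t) = x +i* y + s +i* t) //.
  by rewrite (_ : `|s| + `|t| = l1 (s +i* t)) //; apply: H; rewrite /l1 /=; lra.
have cl1 (x y : R) A : `|x| < q -> `|y| < q -> cderiv g (x +i* y) A ->
    closed_at (fun x y => Re (G x y)) (fun x y => - Im (G x y)) x y (Re A) (- Im A) (- Re A).
  move=> xq yq hA e e0; have [d d0 H] := dG x y A xq yq hA e e0.
  exists d => // s t sd td; have {}H := H s t sd td.
  split; apply: le_trans H; [apply: le_trans (ler_Re_l1 _)|rewrite -normrN; apply: le_trans (ler_Im_l1 _)];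
    by rewrite le_eqVlt; apply/orP; left; apply/eqP; congr (`| _ |); rewrite !ReImE /=; ring.
have cl2 (x y : R) A : `|x| < q -> `|y| < q -> cderiv g (x +i* y) A ->
    closed_at (fun x y => Im (G x y)) (fun x y => Re (G x y)) x y (Im A) (Re A) (- Im A).
  move=> xq yq hA e e0; have [d d0 H] := dG x y A xq yq hA e e0.
  exists d => // s t sd td; have {}H := H s t sd td.
  split; apply: le_trans H; [apply: le_trans (ler_Im_l1 _)|apply: le_trans (ler_Re_l1 _)];
    by rewrite le_eqVlt; apply/orP; left; apply/eqP; congr (`| _ |); rewrite !ReImE /=; ring.
have gd' (x y : R) : `|x| < q -> `|y| < q -> exists A, cderiv g (x +i* y) A.
  by move=> xq yq; apply: gd; apply: lt_trans qr.
have [F1 HF1] := closed_form_primitive q0 Rx nIy (fun x y xq yq =>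
   let: ex_intro A hA := gd' x y xq yq in ex_intro _ _ (ex_intro _ _ (ex_intro _ _ (cl1 x y A xq yq hA)))).
have [F2 HF2] := closed_form_primitive q0 Ix Ry (fun x y xq yq =>
   let: ex_intro A hA := gd' x y xq yq in ex_intro _ _ (ex_intro _ _ (ex_intro _ _ (cl2 x y A xq yq hA)))).
exists (fun z => F1 (Re z) (Im z) +i* F2 (Re z) (Im z)) => -[x y] /= xq yq.
(* The quadratic terms of [F1] and [F2] are the real and imaginary parts of [A * w ^+ 2 / 2]. *)
have [A hA] := gd' x y xq yq; exists (A / 2) => e e0.
have e20 : 0 < e / 2 by rewrite divr_gt0.
have [d1 d10 {}HF1] := HF1 _ _ _ _ _ xq yq (cl1 _ _ _ xq yq hA) _ e20.
have [d2 d20 {}HF2] := HF2 _ _ _ _ _ xq yq (cl2 _ _ _ xq yq hA) _ e20.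
exists (Num.min d1 d2); first by rewrite lt_min d10.
move=> [s t]; rewrite lt_min => /andP[h1 h2].
have h1s := le_lt_trans (ler_Re_l1 _) h1; have h1t := le_lt_trans (ler_Im_l1 _) h1.
have h2s := le_lt_trans (ler_Re_l1 _) h2; have h2t := le_lt_trans (ler_Im_l1 _) h2.
have {}HF1 := HF1 s t h1s h1t; have {}HF2 := HF2 s t h2s h2t.
have EG : G x y = g (x +i* y) by rewrite /G (cl_id _ (ltW xq)) (cl_id _ (ltW yq)).
rewrite EG in HF1 HF2.
have EA : A / 2 = (Re A / 2) +i* (Im A / 2).
  rewrite -[A in LHS](_ : (Re A / 2 +i* (Im A / 2)) * 2 = A); last first.
    by rewrite mulr_natr mulr2n; apply: complex_eqP; rewrite ReImE /=; field.
  by rewrite mulfK // pnatr_eq0.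
rewrite EA /l1 expr2 !ReImE /=.
set u := (X in `|X| + _); set v := (X in _ + `|X|).
have -> : e * (`|s| + `|t|) ^+ 2 = e / 2 * (`|s| + `|t|) ^+ 2 + e / 2 * (`|s| + `|t|) ^+ 2 by field.
apply: lerD; [apply: le_trans HF1|apply: le_trans HF2];
  by rewrite le_eqVlt; apply/orP; left; apply/eqP; congr (`| _ |); rewrite /u /v; field.
Qed.

End Holomorphic1.

(** * Maximum principle and identity theorem in one variable *)

Section Identity1.
Variable R : realType.
Local Notation C := R[i].
Implicit Types (z w A B : C) (h g : C -> C).

Definition in_square (s : R) z := (`|Re z| <= s) && (`|Im z| <= s).

(* At an interior maximum of Re h + e |z|^2 the symmetric second difference of
   Re h would be at most - 4 e t^2. *)
Lemma max_principle h (s m : R) : 0 < s ->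
  (forall z, in_square s z -> twice_diff h z) ->
  (forall z, in_square s z -> s <= `|Re z| \/ s <= `|Im z| -> Re (h z) <= m) ->
  forall z, in_square s z -> Re (h z) <= m.
Proof.
move=> s0 hd hb z0 z0s; rewrite leNgt; apply/negP => mz0.
(* On the boundary [e |z|^2] is at most [2 * e * s ^+ 2], half of [Re (h z0) - m]. The perturbed
   function is thus smaller there than at [z0], and its maximum is interior. *)
pose e := (Re (h z0) - m) / (4 * s ^+ 2).
have s20 : 0 < s ^+ 2 by rewrite exprn_gt0.
have e0 : 0 < e by rewrite divr_gt0 ?subr_gt0 // mulr_gt0.
have eE : e * s ^+ 2 * 4 = Re (h z0) - m by rewrite /e; field; rewrite gt_eqF.
pose U (x y : R) := Re (h (x +i* y)) + e * (x ^+ 2 + y ^+ 2).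
have [|x [y [xs ys Umax]]] := @square_max R U s (ltW s0).
  move=> x y xs ys e' e'0.
  have e'20 : 0 < e' / 2 by rewrite divr_gt0.
  have xy : in_square s (x +i* y) by rewrite /in_square /= xs ys.
  have [d d0 H] := twice_diff_continuous (hd _ xy) e'20.
  pose K := e * (4 * s + 2); have K0 : 0 < K by rewrite mulr_gt0 //; lra.
  exists (Num.min (d / 2) (Num.min 1 (e' / 2 / K))).
    by rewrite !lt_min ltr01 !divr_gt0.
  move=> a b; rewrite !lt_min => /and3P[ad a1 aK] /and3P[bd b1 bK].
  have h1 : `|Re (h (x +i* y + a +i* b)) - Re (h (x +i* y))| < e' / 2.
    rewrite -complex_ReN -complex_ReD; apply: le_lt_trans (ler_Re_l1 _) _; apply: H.
    by rewrite /l1 /=; lra.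
  have sq u v : `|u| <= s -> `|v| < 1 -> `|v| < e' / 2 / K -> `|e * ((u + v) ^+ 2 - u ^+ 2)| <= e' / 4.
    move=> us v1 vK; have -> : e * ((u + v) ^+ 2 - u ^+ 2) = e * (v * (2 * u + v)) by ring.
    rewrite normrM (gtr0_norm e0) normrM.
    have h2 : `|2 * u + v| <= 2 * s + 1.
      by apply: le_trans (ler_normD _ _) _; rewrite normrM (ger0_norm (_ : 0 <= 2)) //; lra.
    have h3 : `|v| * K <= e' / 2 by rewrite -ler_pdivlMr // ltW.
    have h4 : `|v| * `|2 * u + v| <= `|v| * (2 * s + 1) by apply: ler_wpM2l.
    have : e * (`|v| * `|2 * u + v|) <= e * (`|v| * (2 * s + 1)) by apply: ler_wpM2l => //; exact: ltW.
    by rewrite /K in h3; lra.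
  have sa := sq x a xs a1 aK; have sb := sq y b ys b1 bK.
  have -> : U (x + a) (y + b) - U x y =
    (Re (h (x +i* y + a +i* b)) - Re (h (x +i* y))) +
    (e * ((x + a) ^+ 2 - x ^+ 2) + e * ((y + b) ^+ 2 - y ^+ 2)).
    by rewrite /U (_ : (x + a) +i* (y + b) = x +i* y + a +i* b) //; ring.
  apply: le_lt_trans (ler_normD _ _) _.
  have := ler_normD (e * ((x + a) ^+ 2 - x ^+ 2)) (e * ((y + b) ^+ 2 - y ^+ 2)).
  lra.
have xy : in_square s (x +i* y) by rewrite /in_square /= xs ys.
have Uz0 : Re (h z0) <= U x y.
  move/andP: z0s => [a b]; apply: le_trans (Umax _ _ a b).
  rewrite /U -(_ : z0 = Re z0 +i* Im z0); last by case: (z0).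
  by rewrite lerDl mulr_ge0 ?addr_ge0 ?sqr_ge0 // ltW.
have sqs (u : R) : `|u| <= s -> u ^+ 2 <= s ^+ 2.
  by move=> us; rewrite -(real_normK (num_real u)) lerXn2r // nnegrE // ltW.
have interior : `|x| < s /\ `|y| < s.
  suff H : ~ (s <= `|x| \/ s <= `|y|) by split; rewrite ltNge; apply/negP => ?; apply: H; auto.
  move=> /(hb _ xy); rewrite /U in Uz0.
  have : e * (x ^+ 2 + y ^+ 2) <= e * (s ^+ 2 + s ^+ 2).
    by apply: ler_wpM2l; [exact: ltW | apply: lerD; exact: sqs].
  lra.
case: interior => xi yi.
have [d d0 H] := twice_diff_harmonic (hd _ xy) e0.
pose t := Num.min (d / 2) (Num.min ((s - `|x|) / 2) ((s - `|y|) / 2)).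
have t0 : 0 < t by rewrite !lt_min !divr_gt0 // subr_gt0.
have [td tx ty] : [/\ t <= d / 2, t <= (s - `|x|) / 2 & t <= (s - `|y|) / 2].
  by rewrite /t; split; rewrite !ge_min lexx ?orbT.
have := H t; rewrite t0 => /(_ ltac:(lra)).
have tn : `|t| = t by rewrite gtr0_norm.
have xp : `|x + t| <= s by apply: le_trans (ler_normD _ _) _; lra.
have xm : `|x - t| <= s by apply: le_trans (ler_normB _ _) _; lra.
have yp : `|y + t| <= s by apply: le_trans (ler_normD _ _) _; lra.
have ym : `|y - t| <= s by apply: le_trans (ler_normB _ _) _; lra.
have -> : x +i* y + t%:C = (x + t) +i* y by apply: complex_eqP; rewrite ReImE /= ?addr0.
have -> : x +i* y - t%:C = (x - t) +i* y by apply: complex_eqP; rewrite !ReImE /= ?subr0.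
have -> : x +i* y + 'i * t%:C = x +i* (y + t) by apply: complex_eqP; rewrite !ReImE /=; ring.
have -> : x +i* y - 'i * t%:C = x +i* (y - t) by apply: complex_eqP; rewrite !ReImE /=; ring.
have := Umax _ _ xp ys; have := Umax _ _ xm ys; have := Umax _ _ xs yp; have := Umax _ _ xs ym.
rewrite /U => u1 u2 u3 u4.
have : 0 < e * t ^+ 2 by rewrite mulr_gt0 // exprn_gt0.
lra.
Qed.

(** Bounding the real parts of [h], [- h], ['i * h] and [- 'i * h] bounds both [Re h] and [Im h];
    their sum costs the factor 2. *)
Lemma max_principle_l1 h (s m : R) : 0 < s ->
  (forall z, in_square s z -> twice_diff h z) ->
  (forall z, in_square s z -> s <= `|Re z| \/ s <= `|Im z| -> l1 (h z) <= m) ->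
  forall z, in_square s z -> l1 (h z) <= 2 * m.
Proof.
move=> s0 hd hb z zs.
have key c (c1 : l1 c = 1) : Re (c * h z) <= m.
  apply: (@max_principle (fun u => c * h u) s) zs => // {z}z zs.
    by apply: twice_diffM; [exact: twice_diff_cst|exact: hd].
  move=> zb; apply: le_trans (ler_norm _) _; apply: le_trans (ler_Re_l1 _) _.
  by apply: le_trans (ler_l1M _ _) _; rewrite c1 mul1r; exact: hb.
have k1 := key 1; have k2 := key (-1); have k3 := key 'i; have k4 := key (- 'i).
rewrite !l1N in k2 k4.
have l11 : l1 (1 : C) = 1 by rewrite /l1 /= normr1 normr0 addr0.
have l1i : l1 ('i : C) = 1 by rewrite /l1 /= normr1 normr0 add0r.
move: (k1 l11) (k2 l11) (k3 l1i) (k4 l1i).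
rewrite !mulNr !mul1r !ReImE /= !mul0r !mul1r => *.
have hr : `|Re (h z)| <= m by rewrite ler_norml; apply/andP; split; lra.
have hi : `|Im (h z)| <= m by rewrite ler_norml; apply/andP; split; lra.
by rewrite /l1; lra.
Qed.

Lemma twice_diff_bounded h (s : R) : 0 < s -> (forall z, in_square s z -> twice_diff h z) ->
  exists M, forall z, in_square s z -> l1 (h z) <= M.
Proof.
move=> s0 hd.
have [|x [y [xs ys H]]] := @square_max R (fun x y => l1 (h (x +i* y))) s (ltW s0).
  move=> x y xs ys e e0.
  have xy : in_square s (x +i* y) by rewrite /in_square /= xs ys.
  have [d d0 H] := twice_diff_continuous (hd _ xy) e0.
  exists (d / 2); first by rewrite divr_gt0.
  move=> a b ad bd; have ab : l1 (a +i* b) < d by rewrite /l1 /=; lra.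
  rewrite (_ : (x + a) +i* (y + b) = x +i* y + a +i* b) //.
  have := H _ ab; set u := h (_ + _); set v := h _ => uv.
  have h1 : l1 u <= l1 (u - v) + l1 v by rewrite {1}(_ : u = u - v + v) ?ler_l1D //; ring.
  have h2 : l1 v <= l1 u + l1 (u - v) by rewrite {1}(_ : v = u - (u - v)) ?ler_l1B //; ring.
  by rewrite ltr_norml; apply/andP; split; lra.
exists (l1 (h (x +i* y))) => -[a b] /andP[/= ha hb'].
exact: H.
Qed.

(* Apply the maximum principle to h / z^n and let n go to infinity. *)
Lemma twice_diff_identity h (s d : R) : 0 < s -> (forall z, in_square s z -> twice_diff h z) ->
  0 < d -> (forall z, l1 z < d -> h z = 0) ->
  forall z, l1 z < s / 4 -> h z = 0.
Proof.
move=> s0 hd d0 h0 z zs.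
have [M HM] := twice_diff_bounded s0 hd.
have zsq : in_square s z.
  by apply/andP; have := ler_Re_l1 z; have := ler_Im_l1 z; split; lra.
have M0 : 0 <= M by apply: le_trans (HM z zsq); exact: l1_ge0.
(* On the boundary [l1 u^-1 <= 2 / s], so the quotient is at most [M * (2 / s) ^+ n.+1]; with
   [l1 z < s / 4] each power of [z] brings a factor [1 / 2]. *)
have bnd n : l1 (h z) <= 2 * M * 2^-1 ^+ n.+1.
  pose k u := h u * (u^-1) ^+ n.+1.
  have kd u : in_square s u -> twice_diff k u.
    (* At the origin the quotient is locally zero, because [h] is. *)
    move=> us; have [u0|u0] := eqVneq u 0.
      by apply: (twice_diff0 d0) => w wd; rewrite /k u0 add0r h0 // mul0r.
    apply: twice_diffM; first exact: hd.
    by apply: twice_diffX; do 2!eexists; exact: taylor2V.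
  have kb u : in_square s u -> s <= `|Re u| \/ s <= `|Im u| -> l1 (k u) <= M * (2 / s) ^+ n.+1.
    move=> us ub; apply: le_trans (ler_l1M _ _) _; apply: ler_pM; try exact: l1_ge0.
      exact: HM.
    apply: le_trans (ler_l1X _ _) _; apply: lerXn2r; rewrite ?nnegrE ?l1_ge0 ?divr_ge0 ?(ltW s0) //.
    apply: le_trans (l1V _) _; rewrite ler_pM2l //.
    have su : s <= l1 u by case: ub => hu; apply: le_trans hu _; [exact: ler_Re_l1|exact: ler_Im_l1].
    by rewrite lef_pV2 // posrE; lra.
  have [->|z0] := eqVneq z 0.
    by rewrite h0 l10 // !mulr_ge0 // exprn_ge0.
  have := max_principle_l1 s0 kd kb zsq => kz.
  have -> : h z = k z * z ^+ n.+1 by rewrite /k exprVn mulfVK // expf_neq0.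
  apply: le_trans (ler_l1M _ _) _.
  apply: le_trans (ler_pM (l1_ge0 _) (l1_ge0 _) kz (ler_l1X _ _)) _.
  rewrite (_ : _ * l1 z ^+ n.+1 = 2 * M * (2 / s * l1 z) ^+ n.+1); last first.
    by rewrite [in RHS]exprMn !mulrA.
  apply: ler_wpM2l; first by rewrite mulr_ge0.
  apply: lerXn2r; rewrite ?nnegrE ?invr_ge0 ?mulr_ge0 ?l1_ge0 ?invr_ge0 ?(ltW s0) //.
  rewrite mulrAC ler_pdivrMr //; lra.
apply/eqP; rewrite -l1_eq0; apply/negPn/negP => hz.
have hz0 : 0 < l1 (h z) by rewrite lt_neqAle eq_sym hz l1_ge0.
have [n Hn] : exists n : nat, 2 * M / l1 (h z) < 2 ^+ n.+1.
  exists (Num.bound (2 * M / l1 (h z))).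
  have H : 0 <= 2 * M / l1 (h z) by rewrite divr_ge0 ?mulr_ge0 // ltW.
  apply: lt_trans (archi_boundP H) _; rewrite -natrX ltr_nat.
  by apply: leq_trans (ltn_expl _ (ltnSn 1)) _; rewrite leq_exp2l.
have := bnd n; rewrite leNgt => /negP; apply.
by rewrite exprVn ltr_pdivrMr ?exprn_gt0 // [ltRHS]mulrC -ltr_pdivrMr.
Qed.

(** The mean value theorem on the segment from 0 to [z], applied to the real and the imaginary part
    of [H]. *)
Lemma cderiv0_const (H g : C -> C) (d : R) z :
  (forall w, l1 w < d -> exists B, taylor2 H w (g w) B) ->
  (forall w, l1 w < d -> g w = 0) -> l1 z < d -> H z = H 0.
Proof.
move=> Ht g0 zd.
have tz (t : R) : 0 <= t <= 1 -> l1 (t%:C * z) < d.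
  move=> /andP[t0 t1]; apply: le_lt_trans zd; apply: le_trans (ler_l1M _ _) _.
  by rewrite {1}/l1 /= normr0 addr0 ger0_norm // ler_piMl ?l1_ge0.
have key (f : C -> R) (f1 : forall w, `|f w| <= l1 w) (fB : forall z w, f (z - w) = f z - f w) :
    f (H z) = f (H 0).
  pose phi (t : R) := f (H (t%:C * z)).
  have dphi (t : R) : 0 <= t <= 1 -> is_derive t 1 phi 0.
    move=> t01; have [B HB] := Ht _ (tz t t01).
    apply: is_derive0_eps => e e0.
    pose K := l1 B + 1; have K0 : 0 < K by rewrite ltr_wpDl ?l1_ge0.
    pose L := l1 z + 1; have L0 : 0 < L by rewrite ltr_wpDl ?l1_ge0.
    have [d' d'0 {}HB] := HB 1 ltr01.
    exists (Num.min (d' / L) (e / (K * L ^+ 2))).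
      by rewrite lt_min !divr_gt0 // mulr_gt0 // exprn_gt0.
    move=> s; rewrite lt_min => /andP[s1 s2].
    have sz : l1 (s%:C * z) <= `|s| * L.
      apply: le_trans (ler_l1M _ _) _; rewrite {1}/l1 /= normr0 addr0.
      by apply: ler_wpM2l; rewrite // /L lerDl.
    have szd : l1 (s%:C * z) < d' by apply: le_lt_trans sz _; rewrite -ltr_pdivlMr.
    have := HB _ szd; rewrite g0 ?tz // mul0r subr0 mul1r.
    rewrite /phi -fB (_ : (t + s)%:C * z = t%:C * z + s%:C * z); last first.
      by rewrite rmorphD /= mulrDl.
    set u := H (_ + _) - _; set v := B * _ => uv.
    apply: le_trans (f1 _) _.
    have : l1 u <= l1 (u - v) + l1 v by rewrite {1}(_ : u = u - v + v) ?ler_l1D //; ring.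
    have : l1 v <= l1 B * l1 (s%:C * z) ^+ 2.
      apply: le_trans (ler_l1M _ _) _; apply: ler_wpM2l; [exact: l1_ge0|exact: ler_l1X].
    move=> v1 u1.
    have u2 : l1 u <= K * l1 (s%:C * z) ^+ 2 by rewrite /K; lra.
    apply: le_trans u2 _.
    have : l1 (s%:C * z) ^+ 2 <= (`|s| * L) ^+ 2.
      by apply: lerXn2r; rewrite ?nnegrE ?l1_ge0 ?mulr_ge0 // ltW.
    move=> /(ler_wpM2l (ltW K0)) h; apply: le_trans h _.
    have : `|s| * (K * L ^+ 2) <= e.
      by rewrite -ler_pdivlMr ?mulr_gt0 ?exprn_gt0 // ltW.
    move=> /(ler_wpM2l (normr_ge0 s)) h; rewrite mulrC in h *; rewrite (mulrC e).
    by apply: le_trans h; rewrite le_eqVlt; apply/orP; left; apply/eqP; ring.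
  have [||c _] := @MVT_segment R phi (fun=> 0) 0 1 ler01.
  - by move=> t; rewrite in_itv /= => /andP[t0 t1]; apply: dphi; rewrite !ltW.
  - apply: derivable_within_continuous => t; rewrite in_itv /= => /dphi h.
    exact: (@ex_derive _ _ _ _ _ _ 0).
  rewrite mul0r /phi rmorph1 rmorph0 mul1r mul0r => /eqP.
  by rewrite subr_eq0 => /eqP.
apply: complex_eqP; apply: key.
- exact: ler_Re_l1.
- by move=> u w; rewrite !ReImE.
- exact: ler_Im_l1.
- by move=> u w; rewrite !ReImE.
Qed.

(** The primitive is available on the square of half-side [r / 2]; [twice_diff_identity] is applied
    on the closed one of half-side [r / 4] and loses another factor 4. There [H - H 0] vanishes, and
    [g] is its first-order coefficient. *)
Theorem complex_identity1 g (r d : R) : 0 < r ->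
  (forall z, `|Re z| < r -> `|Im z| < r -> exists A, cderiv g z A) ->
  0 < d -> (forall z, l1 z < d -> g z = 0) ->
  forall z, l1 z < r / 16 -> g z = 0.
Proof.
move=> r0 gd d0 g0.
have [H HT] := complex_primitive r0 gd.
have r4 : 0 < r / 4 by rewrite divr_gt0.
pose d' := Num.min d (r / 2); have d'0 : 0 < d' by rewrite lt_min d0 divr_gt0.
have T0 w : l1 w < d' -> exists B, taylor2 H w (g w) B.
  rewrite lt_min => /andP[_ wr].
  by apply: HT; apply: le_lt_trans wr; [exact: ler_Re_l1|exact: ler_Im_l1].
pose h z := H z - H 0.
have hT z : `|Re z| < r / 2 -> `|Im z| < r / 2 -> exists B, taylor2 h z (g z) B.
  move=> z1 z2; have [B HB] := HT z z1 z2; exists B => e /HB[dd dd0 Hd].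
  exists dd => // w /Hd; rewrite /h (_ : H (z + w) - H 0 - (H z - H 0) = H (z + w) - H z) //.
  by ring.
have h0 w : l1 w < d' -> h w = 0.
  move=> wd; rewrite /h (cderiv0_const T0 _ wd) ?subrr // => u.
  by rewrite lt_min => /andP[/g0].
have hz : forall z, l1 z < r / 4 / 4 -> h z = 0.
  apply: (twice_diff_identity r4 _ d'0 h0) => z /andP[z1 z2].
  have [||B HB] := hT z; [by lra|by lra|].
  by exists (g z), B.
move=> z zr; apply/eqP; rewrite -l1_eq0; apply/negPn/negP => gz0.
have gz : 0 < l1 (g z) by rewrite lt_neqAle eq_sym gz0 l1_ge0.
have [||B HB] := hT z.
- by apply: le_lt_trans (ler_Re_l1 _) _; lra.
- by apply: le_lt_trans (ler_Im_l1 _) _; lra.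
have [e e0 {}HB] := HB 1 ltr01.
pose K := l1 B + 1; have K0 : 0 < K by rewrite ltr_wpDl ?l1_ge0.
(* The last bound makes the quadratic error [K * t ^+ 2] at most half of the linear term
   [t * l1 (g z)]. *)
pose t := Num.min (e / 2) (Num.min ((r / 16 - l1 z) / 2) (l1 (g z) / (2 * K))).
have t0 : 0 < t by rewrite !lt_min !divr_gt0 ?subr_gt0 // mulr_gt0.
have [te tr tK] : [/\ t <= e / 2, t <= (r / 16 - l1 z) / 2 & t <= l1 (g z) / (2 * K)].
  by rewrite /t; split; rewrite !ge_min lexx ?orbT.
have l1t : l1 t%:C = t by rewrite /l1 /= normr0 addr0 gtr0_norm.
have := HB t%:C; rewrite l1t mul1r => /(_ ltac:(lra)).
rewrite hz; last by apply: le_lt_trans (ler_l1D _ _) _; rewrite l1t; lra.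
rewrite hz; last by lra.
rewrite !subr0 sub0r => h1.
have h2 : l1 (- (g z * t%:C)) <= l1 (- (g z * t%:C) - B * t%:C ^+ 2) + l1 (B * t%:C ^+ 2).
  by rewrite {1}(_ : - (g z * t%:C) = - (g z * t%:C) - B * t%:C ^+ 2 + B * t%:C ^+ 2) ?ler_l1D //; ring.
have h3 : l1 (B * t%:C ^+ 2) <= l1 B * t ^+ 2.
  apply: le_trans (ler_l1M _ _) _; apply: ler_wpM2l; first exact: l1_ge0.
  by apply: le_trans (ler_l1X _ _) _; rewrite l1t.
have h4 : l1 (- (g z * t%:C)) = t * l1 (g z).
  rewrite l1N /l1 !ReImE /= !mulr0 subr0 add0r !normrM (gtr0_norm t0); ring.
have : t * (2 * K) <= l1 (g z) by rewrite -ler_pdivlMr // mulr_gt0.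
move=> /(ler_wpM2l (ltW t0)).
have : 0 < t * l1 (g z) by rewrite mulr_gt0.
rewrite /K; lra.
Qed.

End Identity1.

(** * The identity theorem for meromorphic functions *)

Section RealNorm.
Variables (R : realType).
Local Notation C := (CC R).

Lemma CC_ge0E (x : C) : 0 <= x -> x = (Re x)%:C :> R[i].
Proof. by case: x => a b /(@ger0_Im R) /= ->. Qed.

Section Normed.
Variable V : normedModType C.
Implicit Types u v : V.

Definition nrm u : R := Re (`|u| : R[i]).

Lemma nrmE u : `|u| = (nrm u)%:C :> R[i].
Proof. exact: CC_ge0E. Qed.

Lemma nrm_ge0 u : 0 <= nrm u.
Proof. by have := normr_ge0 u; rewrite nrmE lecR. Qed.

Lemma nrm0 : nrm 0 = 0. Proof. by rewrite /nrm normr0. Qed.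

Lemma nrmN u : nrm (- u) = nrm u. Proof. by rewrite /nrm normrN. Qed.

Lemma nrmB u v : nrm (u - v) = nrm (v - u).
Proof. by rewrite -nrmN opprB. Qed.

Lemma ler_nrmD u v : nrm (u + v) <= nrm u + nrm v.
Proof. by have := ler_normD u v; rewrite !nrmE -rmorphD lecR. Qed.

Lemma ler_nrmB u v w : nrm (u - w) <= nrm (u - v) + nrm (v - w).
Proof. by rewrite -(subrKA v u (- w)) ler_nrmD. Qed.

Lemma near_nrmP (P : set V) u :
  (\forall v \near u, P v) <-> exists2 d : R, 0 < d & forall v, nrm (v - u) < d -> P v.
Proof.
split=> [/nbhs_normP[/= d d0 H]|[d d0 H]].
  have dE := CC_ge0E (ltW d0).
  exists (Re (d : R[i])); first by rewrite -ltcR -dE.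
  by move=> v vd; apply: H; rewrite /= distrC nrmE dE ltcR.
apply/nbhs_normP; exists (d%:C : C); first by rewrite /= ltcR.
by move=> v /=; rewrite distrC nrmE ltcR => /H.
Qed.

End Normed.

Lemma nrmZ (V : normedModType C) (k : C) (u : V) : nrm (k *: u) = nrm (k : C) * nrm u.
Proof. by apply: complexI; rewrite -nrmE normrZ rmorphM /= -!nrmE. Qed.

Lemma nrm_le_l1 (z : C) : nrm (z : C) <= l1 (z : R[i]).
Proof.
have -> : nrm (z : C) = ComplexField.Normc.normc (z : R[i]) by [].
case: z => a b /=; rewrite /l1 /= -[leRHS]ger0_norm ?addr_ge0 // -sqrtr_sqr.
apply: ler_wsqrtr; rewrite sqrrD !real_normK ?num_real //.
by rewrite lerD2r lerDl mulrn_wge0 // mulr_ge0.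
Qed.

Lemma l1_le_nrm (z : C) : l1 (z : R[i]) <= 2 * nrm (z : C).
Proof.
have -> : nrm (z : C) = ComplexField.Normc.normc (z : R[i]) by [].
case: z => a b /=; rewrite /l1 /=.
have h1 : `|a| <= Num.sqrt (a ^+ 2 + b ^+ 2).
  by rewrite -sqrtr_sqr; apply: ler_wsqrtr; rewrite lerDl sqr_ge0.
have h2 : `|b| <= Num.sqrt (a ^+ 2 + b ^+ 2).
  by rewrite -sqrtr_sqr; apply: ler_wsqrtr; rewrite lerDr sqr_ge0.
lra.
Qed.

Lemma differentiable_cderiv (g : C -> C) (z : C) :
  differentiable (g : C -> C) z -> exists A, cderiv (g : R[i] -> R[i]) z A.
Proof.
move=> /derivable1_diffP /cvg_ex[A /cvgrPdist_le HA]; exists A => e e0.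
have e40 : 0 < (e / 2)%:C :> R[i] by rewrite ltcR divr_gt0.
have [d d0 H] := (near_nrmP _ _).1 (HA _ e40 : \forall h \near (0 : C), h != 0 -> _).
exists d => // w wd.
have [->|w0] := eqVneq w 0; first by rewrite addr0 subrr mulr0 subr0 l10 mulr0.
have := H w; rewrite subr0 => /(_ (le_lt_trans (nrm_le_l1 _) wd) w0).
rewrite nrmE lecR => h.
have -> : g (z + w) - g z - A * w = - (A - w^-1 *: ((g (w *: (1:C) + z) : C) - g z)) * w.
  rewrite /GRing.scale /= mulr1 (addrC w z) opprB mulrBl mulrAC mulVf // mul1r.
  by [].
apply: le_trans (ler_l1M _ _) _; apply: ler_wpM2r; first exact: l1_ge0.
by rewrite l1N; apply: le_trans (l1_le_nrm _) _; lra.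
Qed.

(** On the complex line through [a'] and [b] this is the one-variable case. The parameter runs over
    a square of half-side 17, so that 1 is within the radius [17 / 16]; it then has norm at most 34,
    and the points stay within [34 * (r / 50) + r / 100 < r] of [a]. *)
Lemma holo_identity_ball n (F : 'rV[C]_n -> C) a a' (r : R) : 0 < r ->
  (forall u, nrm (u - a) < r -> differentiable (F : _ -> C) u) ->
  nrm (a' - a) < r / 100 -> (\forall u \near a', F u = 0) ->
  forall b, nrm (b - a) < r / 100 -> F b = 0.
Proof.
move=> r0 Fd a'a /near_nrmP[d d0 F0] b ba.
pose w := b - a'.
have wr : nrm w < r / 50.
  by apply: le_lt_trans (ler_nrmB _ a _) _; rewrite (nrmB a); lra.
pose g (t : C) : C := F (a' + t *: w).
have nt (t : C) (s : R) : nrm (t : C) <= s -> 0 <= s -> nrm (a' + t *: w - a') <= s * (r / 50).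
  by move=> ts s0; rewrite addrAC subrr add0r nrmZ; apply: ler_pM => //; [exact: nrm_ge0..|exact: ltW].
have gd (z : R[i]) : `|Re z| < 17 -> `|Im z| < 17 -> exists A, cderiv (g : R[i] -> R[i]) z A.
  move=> z1 z2; apply: differentiable_cderiv.
  have zn : nrm (z : C) <= 34 by apply: le_trans (nrm_le_l1 _) _; rewrite /l1; lra.
  apply: (@differentiable_comp _ C _ C (fun t : C => a' + t *: w) F).
    apply: differentiableD; first exact: differentiable_cst.
    exact: differentiableZl.
  apply: Fd; apply: le_lt_trans (ler_nrmB _ a' _) _.
  have := nt z 34 zn (ltac:(lra)); lra.
pose dd := d / (nrm w + 1).
have nw : 0 < nrm w + 1 by rewrite ltr_wpDl ?nrm_ge0.
have dd0 : 0 < dd by rewrite divr_gt0.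
have g0 (z : R[i]) : l1 z < dd -> g z = 0.
  move=> zd; apply: F0; rewrite addrAC subrr add0r nrmZ.
  apply: (@le_lt_trans _ _ (l1 z * (nrm w + 1))).
    apply: ler_pM; rewrite ?nrm_ge0 ?nrm_le_l1 // lerDl //.
  by rewrite -ltr_pdivlMr.
have := @complex_identity1 R g 17 dd ltac:(lra) gd dd0 g0 1.
rewrite /g scale1r /w subrKC; apply.
by rewrite /l1 /= normr1 normr0; lra.
Qed.

End RealNorm.

(** * Differentiability of polynomial expressions *)

Section Differentiability.
Variables (K : numFieldType) (V : normedModType K).

Lemma nbhsW (x : V) (P : set V) : (forall u, P u) -> \forall u \near x, P u.
Proof. by move=> H; apply: filterE. Qed.

Lemma nbhsS2 (x : V) (P Q S : set V) : (forall u, P u -> Q u -> S u) ->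
  (\forall u \near x, P u) -> (\forall u \near x, Q u) -> \forall u \near x, S u.
Proof. exact: filterS2. Qed.

Lemma nbhsS3 (x : V) (P Q S T : set V) : (forall u, P u -> Q u -> S u -> T u) ->
  (\forall u \near x, P u) -> (\forall u \near x, Q u) -> (\forall u \near x, S u) ->
  \forall u \near x, T u.
Proof. exact: filterS3. Qed.

Lemma nbhs_forall (I : finType) (x : V) (P : I -> set V) :
  (forall i, \forall u \near x, P i u) -> \forall u \near x, forall i, P i u.
Proof. exact: filter_forall. Qed.

Lemma near_eq_differentiable (W : normedModType K) (f g : V -> W) x :
  (\forall u \near x, f u = g u) -> differentiable g x -> differentiable f x.
Proof.
move=> fg dg; have [dc /eqaddoP H] := (diff_locallyP _ _).1 dg.
have fgx : f x = g x by exact: nbhs_singleton fg.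
have E : f \o shift x = cst (f x) + 'd g x +o_ 0 id.
  apply/eqaddoP => e e0; have := H e e0; apply: filter_app.
  have : \forall h \near (0 : V), f (h + x) = g (h + x).
    move/nbhs_normP: fg => [d d0 Hd]; apply/nbhs_normP; exists d => // h /=.
    rewrite sub0r normrN => hd; apply: Hd => /=.
    by rewrite opprD addrCA subrr addr0 normrN.
  by apply: filter_app; apply: nbhsW => h fgh; rewrite !fctE /= fgh fgx.
have E' := diff_unique dc E.
by apply/diff_locallyP; split; rewrite E'.
Qed.

Lemma differentiable_prod_seq (I : Type) (s : seq I) (f : I -> V -> K) x :
  (forall i, differentiable (f i) x) -> differentiable (fun u => \prod_(i <- s) f i u) x.
Proof.
move=> fd; elim: s => [|i s IH].
  by rewrite (_ : (fun _ => _) = cst 1); [exact: differentiable_cst|apply/funext => u; rewrite big_nil].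
rewrite (_ : (fun _ => _) = f i * (fun u => \prod_(i <- s) f i u)); first exact: differentiableM.
by apply/funext => u; rewrite big_cons.
Qed.

Lemma differentiable_sum_seq (I : Type) (s : seq I) (f : I -> V -> K) x :
  (forall i, differentiable (f i) x) -> differentiable (fun u => \sum_(i <- s) f i u) x.
Proof.
move=> fd; elim: s => [|i s IH].
  by rewrite (_ : (fun _ => _) = cst 0); [exact: differentiable_cst|apply/funext => u; rewrite big_nil].
rewrite (_ : (fun _ => _) = f i + (fun u => \sum_(i <- s) f i u)); first exact: differentiableD.
by apply/funext => u; rewrite big_cons.
Qed.

Lemma differentiable_exp (f : V -> K) k x : differentiable f x ->
  differentiable (fun u => f u ^+ k) x.
Proof.
move=> fd; elim: k => [|k IH].
  by rewrite (_ : (fun _ => _) = cst 1); [exact: differentiable_cst|apply/funext => u; rewrite expr0].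
rewrite (_ : (fun _ => _) = f * (fun u => f u ^+ k)); first exact: differentiableM.
by apply/funext => u; rewrite exprS.
Qed.

Lemma differentiable_mul (f g : V -> K) x : differentiable f x -> differentiable g x ->
  differentiable (fun u => f u * g u) x.
Proof. exact: differentiableM. Qed.

Lemma differentiable_scale (f : V -> K) c x : differentiable f x ->
  differentiable (fun u => c * f u) x.
Proof. by move=> fd; apply: differentiableM => //; exact: differentiable_cst. Qed.

Lemma differentiable_meval m (f : 'I_m -> V -> K) (Q : mpoly m K) x :
  (forall i, differentiable (f i) x) -> differentiable (fun u => meval (f^~ u) Q) x.
Proof.
move=> fd; apply: differentiable_sum_seq => e; apply: differentiable_scale.
by apply: differentiable_prod_seq => i; exact: differentiable_exp.
Qed.

End Differentiability.

(** * Meromorphic functions and dense open conditions *)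

Section Meromorphic.
Variables (R : realType) (n : nat).
Local Notation C := (CC R).
Local Notation Cn := 'rV[C]_n.
Implicit Types (f g h : Cn -> C) (a u v : Cn).

Definition dense_pred (P : Cn -> Prop) : Prop :=
  forall a (d : R), 0 < d -> exists2 u, nrm (u - a) < d & P u.

Lemma near_near a (P : Cn -> Prop) : (\forall u \near a, P u) ->
  \forall u \near a, \forall v \near u, P v.
Proof.
move=> /near_nrmP[d d0 H]; apply/near_nrmP; exists d => // u ud.
apply/near_nrmP; exists (d - nrm (u - a)); first by rewrite subr_gt0.
by move=> v vu; apply: H; apply: le_lt_trans (ler_nrmB _ u _) _; lra.
Qed.

Lemma holomorphic_near f a : holomorphic_at f a -> \forall u \near a, holomorphic_at f u.
Proof. exact: near_near. Qed.

Lemma holomorphic_differentiable f a : holomorphic_at f a -> differentiable f a.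
Proof. exact: nbhs_singleton. Qed.

Lemma differentiable_near_neq0 f a : differentiable f a -> f a != 0 ->
  \forall u \near a, f u != 0.
Proof.
move=> /differentiable_continuous fc fa.
exact: (cvgr_neq0 _ fc fa).
Qed.

(** Conditions are added one at a time, inside a ball on which the earlier ones persist. The version
    relative to a ball serves denominators, which are controlled only locally. *)
Lemma dense_and_open (I : eqType) (s : seq I) (P : I -> Cn -> Prop) (a : Cn) (r : R) :
  (forall i u, P i u -> \forall v \near u, P i v) ->
  (forall i u (d : R), nrm (u - a) < r -> 0 < d -> exists2 v, nrm (v - u) < d & P i v) ->
  forall u (d : R), nrm (u - a) < r -> 0 < d ->
    exists2 v, nrm (v - u) < d & nrm (v - a) < r /\ forall i, i \in s -> P i v.
Proof.
move=> Po Pd; elim: s => [|i s IH] u d ur d0.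
  by exists u; rewrite ?subrr ?nrm0.
have [v vd [vr Pv]] := IH u d ur d0.
have Pn : \forall w \near v, forall j, j \in s -> P j w.
  elim: (s) Pv => [|j t IHt] Pv; first by apply: nbhsW => w j; rewrite in_nil.
  have h1 := Po j v (Pv j (mem_head _ _)).
  have h2 := IHt (fun k kt => Pv k (ltac:(by rewrite inE kt orbT))).
  apply: nbhsS2 h1 h2 => w h1 h2 k.
  by rewrite inE => /orP[/eqP ->|/h2].
have [e e0 He] := (near_nrmP _ _).1 Pn.
pose dd := Num.min e (Num.min (d - nrm (v - u)) (r - nrm (v - a))).
have dd0 : 0 < dd by rewrite !lt_min e0 !subr_gt0 vd vr.
have [w wv Pw] := Pd i v dd vr dd0.
move: wv; rewrite !lt_min => /and3P[w1 w2 w3].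
exists w; first by apply: le_lt_trans (ler_nrmB _ v _) _; lra.
split; first by apply: le_lt_trans (ler_nrmB _ v _) _; lra.
by move=> j; rewrite inE => /orP[/eqP ->//|/(He w w1)].
Qed.

Lemma holomorphic_quotient f g h u :
  (\forall v \near u, [/\ differentiable g v, differentiable h v & (h v != 0 -> f v = g v / h v)]) ->
  h u != 0 -> holomorphic_at f u.
Proof.
move=> Hu hu.
have hd : differentiable h u by have [] := nbhs_singleton Hu.
have hn := near_near (differentiable_near_neq0 hd hu).
have Hn := near_near Hu.
rewrite /holomorphic_at; apply: nbhsS2 Hn hn => v Hv hv.
have [gv hvd _] := nbhs_singleton Hv.
apply: (@near_eq_differentiable _ _ _ _ (g * (fun w => (h w)^-1))).
  by apply: nbhsS2 Hv hv => w [_ _ fw] /fw.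
have hv0 : h v != 0 := nbhs_singleton hv.
exact: (differentiableM gv (differentiableV hvd hv0)).
Qed.

Lemma meromorphic_dense_holomorphic f : meromorphic f -> dense_pred (holomorphic_at f).
Proof.
move=> fm a d d0; have [g [h [gh hh hn0 fE]]] := fm a.
have near3 : \forall u \near a, \forall v \near u,
    [/\ differentiable g v, differentiable h v & (h v != 0 -> f v = g v / h v)].
  by apply: near_near; apply: nbhsS3 gh hh fE => u.
have [e e0 H] := (near_nrmP _ _).1 near3.
have [u ud hu] : exists2 u, nrm (u - a) < Num.min d e & h u != 0.
  apply: contrapT => no; apply: hn0; apply/near_nrmP.
  exists (Num.min d e); first by rewrite lt_min d0.
  by move=> u ud; apply/eqP/negPn/negP => hu; apply: no; exists u.
move: ud; rewrite lt_min => /andP[ud ue]; exists u => //.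
exact: holomorphic_quotient (H u ue) hu.
Qed.

End Meromorphic.

Lemma msupp_le_msize (K : ringType) m (Q : mpoly m K) e i : e \in msupp Q -> (e i <= msize Q)%N.
Proof.
move=> /msize_mdeg_lt h; apply: ltnW; apply: leq_ltn_trans h.
by rewrite mdegE (bigD1 i) //= leq_addr.
Qed.

(** * Identity theorem for polynomial expressions in meromorphic functions *)

Section DenseNonvanishing.
Variables (R : realType) (n m : nat).
Local Notation C := (CC R).
Local Notation Cn := 'rV[C]_n.
Variables (psi : 'I_m -> Cn -> C) (Q : mpoly m C).
Hypothesis psi_mero : forall i, meromorphic (psi i).

Let good (u : Cn) := forall i, holomorphic_at (psi i) u.

(** The germ at [a] of the meromorphic function [Q(psi)] is zero. Only good points are tested, the
    other values being arbitrary. *)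
Definition vanishes_near (a : Cn) : Prop := \forall u \near a, good u -> meval (psi^~ u) Q = 0.

Lemma good_neq0_open (a : Cn) : good a -> meval (psi^~ a) Q != 0 ->
  \forall u \near a, good u /\ meval (psi^~ u) Q != 0.
Proof.
move=> ga qa.
have h1 : \forall u \near a, forall i, holomorphic_at (psi i) u.
  by apply: nbhs_forall => i; exact: holomorphic_near.
have dq : differentiable (fun u => meval (psi^~ u) Q) a.
  by apply: differentiable_meval => i; exact: holomorphic_differentiable.
exact: nbhsS2 (fun u gu qu => conj gu qu) h1 (differentiable_near_neq0 dq qa).
Qed.

(* Clearing the denominators of [psi i = g i / h i] turns the relation into the
   vanishing of a holomorphic function on a ball. *)
Lemma vanishes_near_local (a : Cn) : exists2 r : R, 0 < r &
  forall b c : Cn, nrm (b - a) < r -> nrm (c - a) < r -> vanishes_near b -> vanishes_near c.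
Proof.
have /choice[gh Hgh] : forall i, exists p : (Cn -> C) * (Cn -> C),
    [/\ holomorphic_at p.1 a, holomorphic_at p.2 a, ~ (\forall u \near a, p.2 u = 0)
      & \forall u \near a, p.2 u != 0 -> psi i u = p.1 u / p.2 u].
  by move=> i; have [g [h ?]] := psi_mero i a; exists (g, h).
pose g i := (gh i).1; pose h i := (gh i).2.
have : \forall u \near a, forall i,
    [/\ differentiable (g i) u, differentiable (h i) u & h i u != 0 -> psi i u = g i u / h i u].
  by apply: nbhs_forall => i; have [h1 h2 _ h3] := Hgh i; apply: nbhsS3 h1 h2 h3 => u.
move=> /near_nrmP[r r0 Hr].
have gd i u : nrm (u - a) < r -> differentiable (g i) u by move=> /Hr /(_ i)[].
have hd i u : nrm (u - a) < r -> differentiable (h i) u by move=> /Hr /(_ i)[].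
have near_ball u : nrm (u - a) < r -> \forall v \near u, nrm (v - a) < r.
  move=> ur; apply/near_nrmP; exists (r - nrm (u - a)); first by rewrite subr_gt0.
  by move=> v vu; apply: le_lt_trans (ler_nrmB _ u _) _; lra.
have hol u : nrm (u - a) < r -> (forall i, h i u != 0) -> good u.
  move=> ur hu i; apply: (@holomorphic_quotient _ _ _ (g i) (h i)) => //.
  apply/near_nrmP; have [e e0 He] := (near_nrmP _ _).1 (near_ball u ur).
  by exists e => // v /He /Hr.
pose D := msize Q.
(* Homogenization with [D] at least every exponent of [Q]: off the zeros of the denominators, [F] is
   the relation times a product of powers of them. *)
pose F u := \sum_(e <- msupp Q) mcoeff e Q * \prod_(i < m) (g i u ^+ e i * h i u ^+ (D - e i)).
have FE u : nrm (u - a) < r -> (forall i, h i u != 0) ->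
    F u = (\prod_(i < m) h i u ^+ D) * meval (psi^~ u) Q.
  move=> ur hu; rewrite /F mevalE mulr_sumr; apply: eq_big_seq => e eQ.
  rewrite mulrCA; congr (_ * _); rewrite -big_split /=; apply: eq_bigr => i _.
  have [_ _ ->//] := Hr u ur i.
  have -> : h i u ^+ D = h i u ^+ (D - e i) * h i u ^+ e i.
    by rewrite -exprD subnK // msupp_le_msize.
  by rewrite expr_div_n -mulrA (mulrCA _ (g i u ^+ e i)) mulfV ?expf_neq0 // mulr1 mulrC.
(* The extra factor forces zeros where some denominator vanishes, since the relation gives no
   information there. *)
pose F' u := F u * \prod_(i < m) h i u.
have Fd u : nrm (u - a) < r -> differentiable F' u.
  move=> ur; apply: differentiable_mul.
    apply: differentiable_sum_seq => e; apply: differentiable_scale.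
    apply: differentiable_prod_seq => i; apply: differentiable_mul.
      by apply: differentiable_exp; exact: gd.
    by apply: differentiable_exp; exact: hd.
  by apply: differentiable_prod_seq => i; exact: hd.
have r1 : 0 < r / 100 by rewrite divr_gt0.
have in_r u : nrm (u - a) < r / 100 -> nrm (u - a) < r.
  by have := nrm_ge0 (u - a); lra.
exists (r / 100); first exact: r1.
move=> b c br cr vb.
have F0 : \forall u \near b, F' u = 0.
  apply: nbhsS2 vb (near_ball b (in_r b br)) => u vu ur.
  have [hu|/forallPn[i /negPn /eqP hi]] := boolP [forall i, h i u != 0].
    have {}hu i : h i u != 0 by exact: (forallP hu).
    by rewrite /F' (FE u ur hu) (vu (hol u ur hu)) mulr0 mul0r.
  by rewrite /F' (bigD1 i) //= hi mul0r mulr0.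
have {}F0 u : nrm (u - a) < r / 100 -> F' u = 0.
  exact: (holo_identity_ball r0 Fd br F0).
(* A denominator vanishing on an open part of the small ball would vanish near [a], where its germ
   is nonzero. *)
have hdense i u (d : R) : nrm (u - a) < r / 100 -> 0 < d ->
    exists2 v, nrm (v - u) < d & h i v != 0.
  move=> ur d0; apply: contrapT => no.
  have [_ _ hi0 _] := Hgh i; apply: hi0.
  apply/near_nrmP; exists (r / 100) => //.
  apply: (holo_identity_ball r0 (hd i) ur); apply/near_nrmP; exists d => // v vu.
  by apply/eqP/negPn/negP => hv; apply: no; exists v.
have hopen i u : nrm (u - a) < r /\ h i u != 0 -> \forall v \near u, nrm (v - a) < r /\ h i v != 0.
  move=> [ur hu]; apply: nbhsS2 (near_ball u ur) (differentiable_near_neq0 (hd i u ur) hu) => //.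
have hdense' i u (d : R) : nrm (u - a) < r / 100 -> 0 < d ->
    exists2 v, nrm (v - u) < d & nrm (v - a) < r /\ h i v != 0.
  move=> ur d0; have [|v] := hdense i u (Num.min d (r - r / 100)) ur.
    by rewrite lt_min d0 subr_gt0 /=; lra.
  rewrite lt_min => /andP[vd vr] hv; exists v => //; split => //.
  by apply: le_lt_trans (ler_nrmB _ u _) _; lra.
have [dc dc0 Hdc] := (near_nrmP _ _).1 (near_ball c (in_r c cr)).
apply/near_nrmP; exists (r / 100 - nrm (c - a)); first by rewrite subr_gt0.
move=> u uc gu; apply/eqP/negPn/negP => qu.
have ur : nrm (u - a) < r / 100 by apply: le_lt_trans (ler_nrmB _ c _) _; lra.
have [e e0 He] := (near_nrmP _ _).1 (good_neq0_open gu qu).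
have [v vu [vr hv]] := dense_and_open (enum 'I_m) hopen hdense' ur e0.
have {}hv i : h i v != 0 by have [] := hv i (mem_enum _ i).
have := F0 v vr; have [_ qv] := He v vu.
have p1 : \prod_(i < m) h i v ^+ D != 0 by apply/prodf_neq0 => i _; rewrite expf_neq0.
have p2 : \prod_(i < m) h i v != 0 by apply/prodf_neq0.
by rewrite /F' FE ?in_r // => /eqP; rewrite !mulf_eq0 (negPf qv) (negPf p1) (negPf p2).
Qed.

(** Connectedness of the segment from [a0] to [a]. If the germ were zero at [a0], the supremum of
    the parameters up to which it stays zero could be exceeded by [vanishes_near_local], unless it
    is 1; this contradicts the value at [a]. *)
Lemma dense_nonvanishing (a : Cn) : good a -> meval (psi^~ a) Q != 0 ->
  dense_pred (fun u => good u /\ meval (psi^~ u) Q != 0).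
Proof.
move=> ga qa a0 d d0; apply: contrapT => no.
have v0 : vanishes_near a0.
  apply/near_nrmP; exists d => // u ud gu; apply/eqP/negPn/negP => qu.
  by apply: no; exists u.
suff va : vanishes_near a by move: qa; rewrite (nbhs_singleton va) ?eqxx.
pose p (t : R) : Cn := a0 + (t%:C : C) *: (a - a0).
have pE (s t : R) : nrm (p s - p t) = `|s - t| * nrm (a - a0).
  rewrite /p opprD addrACA subrr add0r -scalerBl nrmZ; congr (_ * _).
  have -> : (s%:C : C) - (t%:C : C) = (s - t)%:C by rewrite -rmorphB.
  by rewrite /nrm normc_def /= expr0n addr0 sqrtr_sqr.
pose S := [set t : R | 0 <= t <= 1 /\ forall s, 0 <= s <= t -> vanishes_near (p s)].
have S0 : S 0.
  split; first by rewrite lexx ler01.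
  by move=> s /le_anti <-; rewrite /p scale0r addr0.
have Sub : has_sup S by split; [exists 0|exists 1 => t [/andP[]]].
pose x := sup S.
have x0 : 0 <= x by apply: ub_le_sup S0; case: Sub.
have x1 : x <= 1 by apply: ge_sup; [case: Sub|move=> t [/andP[]]].
have [r r0 Hr] := vanishes_near_local (p x).
pose e := r / (nrm (a - a0) + 1).
have na : 0 < nrm (a - a0) + 1 by rewrite ltr_wpDl ?nrm_ge0.
have e0 : 0 < e by rewrite divr_gt0.
have close (t : R) : `|t - x| < e -> nrm (p t - p x) < r.
  move=> tx; rewrite pE; apply: (@le_lt_trans _ _ (`|t - x| * (nrm (a - a0) + 1))).
    by apply: ler_wpM2l => //; rewrite lerDl.
  by rewrite -ltr_pdivlMr.
have [t [/andP[t0 t1] St] tx] := sup_adherent e0 Sub.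
have tx' : t <= x by apply: ub_le_sup; [case: Sub|split => //; rewrite t0].
have vx (s : R) : `|s - x| < e -> vanishes_near (p s).
  move=> sx; apply: (Hr (p t)); [|exact: close|by apply: St; rewrite t0 lexx].
  by apply: close; rewrite ltr_norml; apply/andP; split; rewrite -/x in tx; lra.
pose y := Num.min 1 (x + e / 2).
have yS : S y.
  have y0 : 0 <= y by rewrite le_min ler01; lra.
  have y1 : y <= 1 by rewrite ge_min lexx.
  have yx : y <= x + e / 2 by rewrite ge_min lexx orbT.
  split; first by rewrite y0 y1.
  move=> s /andP[s0 sy]; have [st|ts] := leP s t; first by apply: St; rewrite s0.
  by apply: vx; rewrite ltr_norml; apply/andP; split; rewrite -/x in tx; lra.
have yx : y <= x by apply: ub_le_sup yS; case: Sub.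
have y1 : y = 1.
  by move: yx; rewrite /y; case: (leP 1 (x + e / 2)) => //; lra.
have [_ H] := yS; have := H 1; rewrite y1 ler01 lexx => /(_ isT).
by rewrite /p scale1r subrKC.
Qed.

End DenseNonvanishing.

(** * Elimination *)

Section Elimination.
Variables (T : Type) (K : fieldType) (n d : nat).
Variables (x l : 'I_n -> T -> K).
Hypothesis d_gt0 : (0 < d)%N.

Definition expo e := ({ffun 'I_n -> 'I_e} * {ffun 'I_n -> 'I_d})%type.

Definition mon (g b : 'I_n -> nat) (t : T) : K := \prod_k (x k t ^+ g k * l k t ^+ b k).

(** The degrees in the [x k] are below [e], those in the [l k] below the fixed [d], so the space has
    dimension at most [(e * d) ^ n]. *)
Definition spanned e (f : T -> K) : Prop :=
  exists a : expo e -> K, forall t, f t = \sum_i a i * mon (fun k => i.1 k) (fun k => i.2 k) t.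

(** [D] does not depend on [e]: products of [N] multipliers raise the degree linearly in [N], as the
    dimension count requires. *)
Definition multiplier (h : T -> K) : Prop :=
  exists D, forall e f, spanned e f -> spanned (e + D) (fun t => h t * f t).

Lemma spanned_ext e f g : f =1 g -> spanned e f -> spanned e g.
Proof. by move=> fg [a ha]; exists a => t; rewrite -fg. Qed.

Lemma spannedD e f g : spanned e f -> spanned e g -> spanned e (fun t => f t + g t).
Proof.
move=> [a ha] [b hb]; exists (fun i => a i + b i) => t.
by rewrite ha hb -big_split; apply: eq_bigr => i _; rewrite mulrDl.
Qed.

Lemma spannedZ e c f : spanned e f -> spanned e (fun t => c * f t).
Proof.
by move=> [a ha]; exists (fun i => c * a i) => t; rewrite ha mulr_sumr; apply: eq_bigr => i _; rewrite mulrA.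
Qed.

Lemma spanned0 e : spanned e (fun=> 0).
Proof. by exists (fun=> 0) => t; rewrite big1 // => i _; rewrite mul0r. Qed.

Lemma spanned_sum (I : Type) (s : seq I) e (F : I -> T -> K) :
  (forall i, spanned e (F i)) -> spanned e (fun t => \sum_(i <- s) F i t).
Proof.
move=> HF; elim: s => [|i s IH].
  by apply: spanned_ext (spanned0 e) => t; rewrite big_nil.
by apply: spanned_ext (spannedD (HF i) IH) => t; rewrite big_cons.
Qed.

Lemma spanned_mon e (g b : 'I_n -> nat) :
  (forall k, g k < e)%N -> (forall k, b k < d)%N -> spanned e (mon g b).
Proof.
move=> ge bd.
pose i0 : expo e := ([ffun k => Ordinal (ge k)], [ffun k => Ordinal (bd k)]).
exists (fun i => (i == i0)%:R) => t; rewrite (bigD1 i0) //= eqxx mul1r.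
rewrite big1 ?addr0; first by apply: eq_bigr => k _; rewrite !ffunE.
by move=> i /negPf ->; rewrite mul0r.
Qed.

Lemma spanned_linear e e' (h : T -> K) :
  (forall g b : 'I_n -> nat, (forall k, g k < e)%N -> (forall k, b k < d)%N ->
     spanned e' (fun t => h t * mon g b t)) ->
  forall f, spanned e f -> spanned e' (fun t => h t * f t).
Proof.
move=> H f [a ha].
apply: (@spanned_ext _ (fun t => \sum_i a i * (h t * mon (fun k => i.1 k) (fun k => i.2 k) t))).
  by move=> t; rewrite ha mulr_sumr; apply: eq_bigr => i _; rewrite mulrCA.
apply: spanned_sum => i; apply: spannedZ; apply: H => k; exact: ltn_ord.
Qed.

Lemma spannedW e e' f : (e <= e')%N -> spanned e f -> spanned e' f.
Proof.
move=> ee sf.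
have : spanned e' (fun t => 1 * f t).
  apply: (@spanned_linear e e' (fun=> 1)) sf => g b ge bd.
  apply: (@spanned_ext _ (mon g b)); first by move=> t; rewrite mul1r.
  by apply: spanned_mon => // k; exact: leq_trans (ge k) ee.
by apply: spanned_ext => t; rewrite mul1r.
Qed.

Lemma multiplier_ext f g : f =1 g -> multiplier f -> multiplier g.
Proof. by move=> fg [D HD]; exists D => e h /HD; apply: spanned_ext => t; rewrite fg. Qed.

Lemma multiplierD f g : multiplier f -> multiplier g -> multiplier (fun t => f t + g t).
Proof.
move=> [D HD] [D' HD']; exists (D + D')%N => e h sh.
apply: (@spanned_ext _ (fun t => f t * h t + g t * h t)); first by move=> t; rewrite mulrDl.
by apply: spannedD; [apply: spannedW (HD _ _ sh)|apply: spannedW (HD' _ _ sh)]; lia.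
Qed.

Lemma multiplierM f g : multiplier f -> multiplier g -> multiplier (fun t => f t * g t).
Proof.
move=> [D HD] [D' HD']; exists (D' + D)%N => e h /HD' /HD.
by rewrite addnA; apply: spanned_ext => t; rewrite mulrA.
Qed.

Lemma multiplierC c : multiplier (fun=> c).
Proof. by exists 0%N => e f sf; rewrite addn0; exact: spannedZ. Qed.

Lemma multiplier_x k : multiplier (x k).
Proof.
exists 1%N => e; apply: spanned_linear => g b ge bd.
apply: (@spanned_ext _ (mon (fun j => g j + (j == k))%N b)).
  move=> t; rewrite /mon (bigD1 k) //= eqxx addn1 exprS [in RHS](bigD1 k) //= !mulrA.
  by congr (_ * _); apply: eq_bigr => j /negPf ->; rewrite addn0.
by apply: spanned_mon => // j; have := ge j; case: (j == k); lia.
Qed.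

Lemma multiplierX f k : multiplier f -> multiplier (fun t => f t ^+ k).
Proof.
move=> mf; elim: k => [|k IH]; first by apply: multiplier_ext (multiplierC 1) => t; rewrite expr0.
by apply: multiplier_ext (multiplierM mf IH) => t; rewrite exprS.
Qed.

Lemma multiplier_prod (I : Type) (s : seq I) (F : I -> T -> K) :
  (forall i, multiplier (F i)) -> multiplier (fun t => \prod_(i <- s) F i t).
Proof.
move=> HF; elim: s => [|i s IH].
  by apply: multiplier_ext (multiplierC 1) => t; rewrite big_nil.
by apply: multiplier_ext (multiplierM (HF i) IH) => t; rewrite big_cons.
Qed.

Lemma multiplier_sum (I : Type) (s : seq I) (F : I -> T -> K) :
  (forall i, multiplier (F i)) -> multiplier (fun t => \sum_(i <- s) F i t).
Proof.
move=> HF; elim: s => [|i s IH].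
  by apply: multiplier_ext (multiplierC 0) => t; rewrite big_nil.
by apply: multiplier_ext (multiplierD (HF i) IH) => t; rewrite big_cons.
Qed.

Lemma multiplier_meval m (psi : 'I_m -> T -> K) (Q : mpoly m K) :
  (forall i, multiplier (psi i)) -> multiplier (fun t => meval (psi^~ t) Q).
Proof.
move=> H; apply: multiplier_sum => e; apply: multiplierM; first exact: multiplierC.
by apply: multiplier_prod => i; exact: multiplierX.
Qed.

Lemma multiplier_bound (I : finType) (F : I -> T -> K) : (forall i, multiplier (F i)) ->
  exists D, forall i e f, spanned e f -> spanned (e + D) (fun t => F i t * f t).
Proof.
move=> /choice[D HD]; exists (\sum_i D i)%N => i e f sf.
by apply: spannedW (HD i e f sf); rewrite leq_add2l (bigD1 i) //= leq_addr.
Qed.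

Variable h : 'I_n -> 'I_d.+1 -> T -> K.
Hypothesis h_mult : forall k j, multiplier (h k j).
Hypothesis h_rel : forall k t, \sum_j h k j t * l k t ^+ j = 0.

Let lead k := h k ord_max.

(* The relation rewrites lead * l^d in terms of lower powers of l. *)
Lemma multiplier_lead k : multiplier (fun t => lead k t * l k t).
Proof.
have [D HD] := multiplier_bound (h_mult k).
exists D => e; apply: spanned_linear => g b ge bd.
pose b' (j : nat) (i : 'I_n) := if i == k then j else b i.
have monE j t : mon g (b' j) t = l k t ^+ j * mon g (b' 0%N) t.
  rewrite /mon (bigD1 k) //= [in RHS](bigD1 k) //= /b' eqxx expr0 mulr1 mulrCA -!mulrA.
  by congr (_ * _); congr (_ * _); apply: eq_bigr => i /negPf ->.
have bE t : mon g b t = l k t ^+ b k * mon g (b' 0%N) t.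
  by rewrite -monE; apply: eq_bigr => i _; rewrite /b'; case: eqP => // ->.
have [lt_bd|le_db] := ltnP (b k).+1 d.
  apply: (@spanned_ext _ (fun t => lead k t * mon g (b' (b k).+1) t)).
    by move=> t; rewrite monE bE exprS; ring.
  by apply: HD; apply: spanned_mon => // i; rewrite /b'; case: eqP.
have bk : (b k).+1 = d by apply/eqP; rewrite eqn_leq bd.
apply: (@spanned_ext _ (fun t => -1 * \sum_(j < d) h k (widen_ord (leqnSn d) j) t * mon g (b' j) t)).
  move=> t; have := h_rel k t; rewrite big_ord_recr /= => /eqP; rewrite addr_eq0 => /eqP E.
  rewrite bE mulrA -(mulrA (lead k t)) -exprS bk.
  rewrite mulN1r -[lead k t * _]opprK -E mulNr mulr_suml; congr (- _).
  by apply: eq_bigr => j _; rewrite monE mulrA.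
apply: spannedZ; apply: spanned_sum => j; apply: HD; apply: spanned_mon => // i.
by rewrite /b'; case: eqP.
Qed.

Let s t := \prod_k lead k t.

(** Multipliers up to a denominator that is a power of [s]. Each [l k] is one, since [lead k * l k]
    is a multiplier and [lead k] divides [s]. *)
Definition smultiplier (f : T -> K) : Prop := exists E, multiplier (fun t => s t ^+ E * f t).

Lemma multiplier_s : multiplier s.
Proof. by apply: multiplier_prod => k; exact: h_mult. Qed.

Lemma smultiplier_le f E : multiplier (fun t => s t ^+ E * f t) ->
  forall E', (E <= E')%N -> multiplier (fun t => s t ^+ E' * f t).
Proof.
move=> mf E' EE; apply: multiplier_ext (multiplierM (multiplierX (E' - E) multiplier_s) mf) => t.
by rewrite mulrA -exprD subnK.
Qed.

Lemma smultiplierW f : multiplier f -> smultiplier f.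
Proof. by move=> mf; exists 0%N; apply: multiplier_ext mf => t; rewrite mul1r. Qed.

Lemma smultiplier_ext f g : f =1 g -> smultiplier f -> smultiplier g.
Proof. by move=> fg [E H]; exists E; apply: multiplier_ext H => t; rewrite fg. Qed.

Lemma smultiplierD f g : smultiplier f -> smultiplier g -> smultiplier (fun t => f t + g t).
Proof.
move=> [E H] [E' H']; exists (E + E')%N.
have := multiplierD (smultiplier_le H (leq_addr E' E)) (smultiplier_le H' (leq_addl E E')).
by apply: multiplier_ext => t; rewrite mulrDr.
Qed.

Lemma smultiplierM f g : smultiplier f -> smultiplier g -> smultiplier (fun t => f t * g t).
Proof.
move=> [E H] [E' H']; exists (E + E')%N; apply: multiplier_ext (multiplierM H H') => t.
by rewrite exprD mulrACA.
Qed.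

Lemma smultiplier_l k : smultiplier (l k).
Proof.
exists 1%N.
pose F j t := if j == k then 1 else lead j t.
have mF j : multiplier (F j).
  by rewrite /F; case: (j == k); [exact: multiplierC|exact: h_mult].
apply: multiplier_ext (multiplierM (multiplier_prod (index_enum 'I_n) mF) (multiplier_lead k)) => t.
rewrite expr1 /s (bigD1 k) //= [in RHS](bigD1 k) //= {1}/F eqxx mul1r mulrA.
congr (_ * _); rewrite mulrC; congr (_ * _).
by apply: eq_bigr => j /negPf jk; rewrite /F jk.
Qed.

Lemma smultiplier_meval m (psi : 'I_m -> T -> K) (Q : mpoly m K) :
  (forall i, smultiplier (psi i)) -> smultiplier (fun t => meval (psi^~ t) Q).
Proof.
move=> H.
have C c : smultiplier (fun=> c) by apply: smultiplierW; exact: multiplierC.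
rewrite /meval /mmap; elim: (msupp Q) => [|e r IH].
  by apply: smultiplier_ext (C 0) => t; rewrite big_nil.
apply: (@smultiplier_ext (fun t => mcoeff e Q * \prod_(i < m) psi i t ^+ e i +
   \sum_(i <- r) mcoeff i Q * mmap1 (psi^~ t) i)); first by move=> t; rewrite big_cons.
apply: smultiplierD => //; apply: smultiplierM => //.
elim: (index_enum _) => [|i q IHq].
  by apply: smultiplier_ext (C 1) => t; rewrite big_nil.
apply: (@smultiplier_ext (fun t => psi i t ^+ e i * \prod_(j <- q) psi j t ^+ e j)).
  by move=> t; rewrite big_cons.
apply: smultiplierM => //; elim: (e i) => [|k IHk].
  by apply: smultiplier_ext (C 1) => t; rewrite expr0.
by apply: smultiplier_ext (smultiplierM (H i) IHk) => t; rewrite exprS.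
Qed.

Lemma exists_large_box D : exists N, ((1 + n.+1 * (N * D)) ^ n * d ^ n < N ^ n.+1)%N.
Proof.
(* The left side is at most [(N * q) ^ n = N ^ n * q ^ n], and [N] exceeds [q ^ n]. *)
pose q := ((1 + n.+1 * D) * d)%N; exists (q ^ n).+1.
set N := (q ^ n).+1.
have le1 : ((1 + n.+1 * (N * D)) * d <= N * q)%N.
  rewrite /q [leqRHS]mulnA leq_mul2r; apply/orP; right.
  have -> : (n.+1 * (N * D) = N * (n.+1 * D))%N by lia.
  by rewrite mulnDr muln1 leq_add2r.
rewrite -expnMn; apply: (@leq_ltn_trans ((N * q) ^ n)%N).
  by case: (n) le1 => // k le1; rewrite leq_exp2r.
by rewrite expnMn expnS mulnC ltn_pmul2r ?expn_gt0.
Qed.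

Lemma exists_kernel p q (M : 'M[K]_(p, q)) : (q < p)%N ->
  exists2 v : 'rV[K]_p, v != 0 & v *m M = 0.
Proof.
move=> qp; have : kermx M != 0.
  rewrite -mxrank_eq0 mxrank_ker subn_eq0 -ltnNge.
  exact: leq_ltn_trans (rank_leq_col M) qp.
move=> /rowV0Pn[v /sub_kermxP vM v0].
by exists v.
Qed.

(* Dimension count: N^(n+1) monomials in [f], multiplied by a common
   denominator, lie in a space of dimension O(N^n). *)
Lemma elimination (f A B : 'I_n.+1 -> T -> K) :
  (forall i, smultiplier (A i)) -> (forall i, smultiplier (B i)) ->
  (forall i t, f i t * B i t = A i t) ->
  exists P : mpoly n.+1 K, P != 0 /\
    forall t, (forall k, lead k t != 0) -> (forall i, B i t != 0) -> meval (f^~ t) P = 0.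
Proof.
move=> sA sB fBA.
have /choice[E HE] : forall i, exists E, multiplier (fun t => s t ^+ E * A i t) /\
    multiplier (fun t => s t ^+ E * B i t).
  move=> i; have [[E1 H1] [E2 H2]] := (sA i, sB i); exists (E1 + E2)%N.
  by split; [exact: smultiplier_le H1 _ (leq_addr _ _)|exact: smultiplier_le H2 _ (leq_addl _ _)].
pose a i t := s t ^+ E i * A i t; pose b i t := s t ^+ E i * B i t.
have [Da HDa] := multiplier_bound (fun i => (HE i).1 : multiplier (a i)).
have [Db HDb] := multiplier_bound (fun i => (HE i).2 : multiplier (b i)).
pose D := maxn Da Db.
have HD (z : bool) i e g : spanned e g -> spanned (e + D) (fun t => (if z then a i t else b i t) * g t).
  by move=> sg; case: z; [apply: spannedW (HDa i e g sg)|apply: spannedW (HDb i e g sg)]; rewrite leq_add2l leq_max leqnn ?orbT.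
have HDX (z : bool) i k e g : spanned e g -> spanned (e + k * D) (fun t => (if z then a i t else b i t) ^+ k * g t).
  move=> sg; elim: k => [|k IH]; first by rewrite addn0; apply: spanned_ext sg => t; rewrite mul1r.
  have -> : (e + k.+1 * D = e + k * D + D)%N by lia.
  by apply: spanned_ext (HD z i _ _ IH) => t; rewrite exprS mulrA.
have [N HN] := exists_large_box D.
pose box := {ffun 'I_n.+1 -> 'I_N}.
(* For each of the [n.+1] indices, [al i + (N - al i) = N] multipliers are applied to the constant
   1, each raising the degree bound by [D]. *)
pose e0 := (1 + n.+1 * (N * D))%N.
have HF (al : box) : spanned e0 (fun t => \prod_i (a i t ^+ al i * b i t ^+ (N - al i))).
  have one : spanned 1 (fun=> 1).
    apply: (@spanned_ext _ (mon (fun=> 0%N) (fun=> 0%N))).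
      by move=> t; rewrite /mon big1 // => k _; rewrite mulr1.
    exact: spanned_mon.
  suff gen (r : seq 'I_n.+1) : spanned (1 + size r * (N * D))
      (fun t => \prod_(i <- r) (a i t ^+ al i * b i t ^+ (N - al i))).
    by have := gen (enum 'I_n.+1); rewrite size_enum_ord; apply: spanned_ext => t; rewrite big_enum.
  elim: r => [|i r IH].
    by apply: spanned_ext one => t; rewrite big_nil.
  have IH2 := HDX true i (al i) _ _ (HDX false i (N - al i)%N _ _ IH).
  have -> : (1 + size (i :: r) * (N * D) = 1 + size r * (N * D) + (N - al i) * D + al i * D)%N.
    by rewrite -addnA -mulnDl subnK /=; [lia|apply: ltnW; exact: ltn_ord].
  by apply: spanned_ext IH2 => t; rewrite big_cons mulrA.
have /choice[co Hco] := HF.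
have card_lt : (#|{: expo e0}| < #|box|)%N.
  by rewrite card_prod !card_ffun !card_ord.
pose M : 'M[K]_(#|box|, #|{: expo e0}|) := \matrix_(i, j) co (enum_val i) (enum_val j).
have [v v0 vM] := exists_kernel M card_lt.
pose w (al : box) := v 0 (enum_rank al).
pose mn (al : box) : multinom n.+1 := Multinom [tuple (al i : nat) | i < n.+1].
(* Distinct boxes give distinct monomials, so a nonzero kernel vector gives a nonzero polynomial. *)
have mn_inj : injective mn.
  by move=> al be /mnmP H; apply/ffunP => i; apply: val_inj; have := H i; rewrite !mnmE.
pose P : mpoly n.+1 K := \sum_al w al *: mpolyX K (mn al).
exists P; split.
  have [i vi] : exists i, v 0 i != 0.
    apply: contrapT => no; move: v0 => /negP; apply; apply/eqP/rowP => i; rewrite mxE.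
    by apply/eqP/negPn/negP => vi; apply: no; exists i.
  apply: contra_neq vi => P0; have := congr1 (mcoeff (mn (enum_val i))) P0.
  rewrite mcoeff0 /P raddf_sum /= (bigD1 (enum_val i)) //= mcoeffZ mcoeffX eqxx mulr1.
  rewrite big1 ?addr0; first by rewrite /w enum_valK.
  by move=> al ali; rewrite mcoeffZ mcoeffX (inj_eq mn_inj) (negPf ali) mulr0.
move=> t lt0 Bt.
have bt i : b i t != 0 by rewrite mulf_neq0 // expf_neq0 //; apply/prodf_neq0.
have fb i : a i t = f i t * b i t by rewrite /a /b -fBA; ring.
(* The common denominator turns every monomial in [f] into the product expanded by [co], and [v]
   annihilates the matrix of these coefficients. *)
have : (\prod_i b i t ^+ N) * meval (f^~ t) P = 0.
  rewrite /P raddf_sum /= mulr_sumr.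
  transitivity (\sum_al w al * \prod_i (a i t ^+ al i * b i t ^+ (N - al i))).
    apply: eq_bigr => al _; rewrite mevalZ mevalX mulrCA -big_split /=; congr (_ * _).
    apply: eq_bigr => i _; rewrite mnmE fb [in RHS]exprMn.
    have -> : b i t ^+ N = b i t ^+ al i * b i t ^+ (N - al i).
      by rewrite -exprD subnKC //; apply: ltnW; exact: ltn_ord.
    by rewrite mulrC mulrA.
  transitivity (\sum_(j : expo e0) (\sum_al w al * co al j) * mon (fun k => j.1 k) (fun k => j.2 k) t).
    under eq_bigr do rewrite Hco mulr_sumr.
    rewrite exchange_big /=; apply: eq_bigr => j _; rewrite mulr_suml.
    by apply: eq_bigr => al _; rewrite mulrA.
  rewrite big1 // => j _.
  have /rowP/(_ (enum_rank j)) := vM; rewrite !mxE => Ej.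
  rewrite (_ : \sum_al _ = 0) ?mul0r // -[RHS]Ej.
  rewrite (reindex (@enum_val box predT)) /=; last first.
    by exists enum_rank => ? _; [exact: enum_valK|exact: enum_rankK].
  by apply: eq_bigr => i _; rewrite mxE enum_rankK /w enum_valK.
move=> /eqP; rewrite mulf_eq0 => /orP[|/eqP //].
by move=> /prodf_eq0[i _]; rewrite expf_eq0 (negPf (bt i)) andbF.
Qed.

End Elimination.

(** * Polynomial relations and derivatives *)

Lemma mpoly_gen_ind (K : comRingType) m (P : mpoly m K -> Prop) :
  (forall c, P (mpolyC m c)) -> (forall i, P (mpolyX K (mnm1 i))) ->
  (forall p q, P p -> P q -> P (p + q)) -> (forall p q, P p -> P q -> P (p * q)) ->
  forall p, P p.
Proof.
move=> PC PX PD PM p; rewrite (mpolyE p).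
have P0 : P 0 by have := PC 0; rewrite mpolyC0.
have P1 : P 1 by have := PC 1; rewrite mpolyC1.
elim: (msupp p) => [|e s IH]; first by rewrite big_nil.
rewrite big_cons; apply: PD IH; rewrite -mul_mpolyC; apply: (PM); first exact: PC.
rewrite mpolyXE_id; elim/big_ind: _ => [//|p1 p2|i _]; first exact: PM.
by elim: (e i) => [|k IHk]; rewrite ?expr0 // exprS; exact: PM.
Qed.

Section MevalDerive.
Variables (K : numFieldType) (V : normedModType K) (m : nat).

Lemma is_derive_meval (f : 'I_m -> V -> K) (df : 'I_m -> K) (Q : mpoly m K) a v :
  (forall i, is_derive a v (f i) (df i)) ->
  is_derive a v (fun u => meval (f^~ u) Q) (\sum_i meval (f^~ a) (mderiv i Q) * df i).
Proof.
move=> fd; elim/mpoly_gen_ind: Q => [c|i|p q IHp IHq|p q IHp IHq].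
- rewrite (_ : (fun _ => _) = cst c); last by apply/funext => u; rewrite mevalC.
  by rewrite big1 => [|i _]; [exact: is_derive_cst|rewrite mderivC meval0 mul0r].
- rewrite (_ : (fun _ => _) = f i); last by apply/funext => u; rewrite mevalXU.
  rewrite (bigD1 i) //= mderivX mnm1E eqxx scale1r.
  have -> : (mnm_sub (mnm1 i) (mnm1 i)) = mnm0.
    by apply/mnmP => j; rewrite mnmBE subnn mnmE.
  rewrite mpolyX0 meval1 mul1r big1 ?addr0 // => j ji.
  by rewrite mderivX mnm1E eq_sym (negPf ji) scale0r meval0 mul0r.
- rewrite (_ : (fun _ => _) = (fun u => meval (f^~ u) p) + (fun u => meval (f^~ u) q)); last first.
    by apply/funext => u; rewrite mevalD.
  apply: is_derive_eq; rewrite -big_split /=; apply: eq_bigr => i _.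
  by rewrite mderivD mevalD mulrDl.
- rewrite (_ : (fun _ => _) = (fun u => meval (f^~ u) p) * (fun u => meval (f^~ u) q)); last first.
    by apply/funext => u; rewrite mevalM.
  apply: is_derive_eq; rewrite /GRing.scale /= !mulr_sumr -big_split /=; apply: eq_bigr => i _.
  by rewrite mderivM mevalD !mevalM; ring.
Qed.

End MevalDerive.

(** * Nonvanishing of polynomials in characteristic zero *)

Section CharZero.
Variables (K : numFieldType) (m : nat).
Implicit Types (Q : mpoly m K).

Lemma msize_mderiv_lt Q i : Q != 0 -> (msize (mderiv i Q) < msize Q)%N.
Proof.
move=> Q0; have [->|D0] := eqVneq (mderiv i Q) 0.
  by rewrite (_ : msize 0 = 0%N) ?lt0n ?msize_poly_eq0 //; exact: mmeasure0.
rewrite msizeE; apply: (@leq_ltn_trans (msize Q).-1); last first.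
  by rewrite ltn_predL lt0n msize_poly_eq0.
apply/bigmax_leqP_seq => e; rewrite mcoeff_msupp mcoeff_deriv => h _.
have : mnm_add e (mnm1 i) \in msupp Q.
  by rewrite mcoeff_msupp; apply: contraNneq h => ->; rewrite mul0rn.
by move/msize_mdeg_lt; rewrite mdegD mdeg1 addn1; case: (msize Q).
Qed.

Lemma mderiv_eq0 Q i e : mderiv i Q = 0 -> e \in msupp Q -> e i = 0%N.
Proof.
move=> D0 eQ; apply/eqP; rewrite -leqn0 leqNgt; apply/negP => ei.
have := congr1 (mcoeff (mnm_sub e (mnm1 i))) D0.
rewrite mcoeff_deriv mcoeff0 (_ : mnm_add _ _ = e); last first.
  apply/mnmP => j; rewrite mnmDE mnmBE mnm1E subnK //.
  by case: eqP => // <-.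
by move/eqP; rewrite mulrn_eq0 /= (negPf (_ : mcoeff e Q != 0)) // -mcoeff_msupp.
Qed.

(** If [Q] vanishes everywhere, so do its partial derivatives, which are smaller and hence zero by
    induction; in characteristic zero [Q] is then a constant. *)
Lemma meval_neq0 Q : Q != 0 -> exists v, meval v Q != 0.
Proof.
have [k] := ubnP (msize Q); elim: k Q => // k IH Q Qk Q0.
apply: contrapT => no.
have Qv v : meval v Q = 0 by apply/eqP/negPn/negP => h; apply: no; exists v.
have D0 i : mderiv i Q = 0.
  apply/eqP/negPn/negP => /[dup] D0 /(IH _ (leq_trans (msize_mderiv_lt i Q0) Qk))[v].
  apply/negP/negPn/eqP.
  pose f j (t : K) := v j + t * (j == i)%:R.
  have fd j : is_derive (0 : K) 1 (f j) ((j == i)%:R).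
    by rewrite /f; apply: is_derive_eq; rewrite add0r scaler0 add0r /GRing.scale /= mulr1.
  have [_ H] := is_derive_meval Q fd.
  have E : (fun u => meval (f^~ u) Q) = cst 0 by apply/funext => u; exact: Qv.
  move: H; rewrite E derive_cst (bigD1 i) //= eqxx mulr1 big1 ?addr0.
    by move=> H0; rewrite [RHS]H0; apply: meval_eq => j; rewrite /f mul0r addr0.
  by move=> j /negPf ->; rewrite mulr0.
have Qc : Q = mpolyC m (mcoeff mnm0 Q).
  apply/mpolyP => e; rewrite mcoeffC; case: (e =P mnm0) => [->|e0]; first by rewrite mulr1.
  rewrite mulr0; apply/eqP; rewrite mcoeff_eq0; apply/negP => eQ; apply: e0.
  by apply/mnmP => i; rewrite (mderiv_eq0 (D0 i) eQ) mnmE.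
have := Qv (fun=> 0); rewrite Qc mevalC => c0.
by move: Q0; rewrite Qc c0 mpolyC0 eqxx.
Qed.

(* Expand [Q] around [x0] into homogeneous parts: the lowest nonzero one
   dominates along [t y] with [t] small and [y] near a point where it does not vanish. *)
Lemma meval_neq0_direction Q (x0 : 'I_m -> K) : Q != 0 ->
  exists (w : 'I_m -> K) (e : K), 0 < e /\ forall (t : K) (y : 'I_m -> K),
    t != 0 -> `|t| < e -> (forall i, `|y i - w i| < e) ->
    meval (fun i => x0 i + t * y i) Q != 0.
Proof.
move=> Q0.
pose Q' := comp_mpoly [tuple (mpolyC m (x0 i) + mpolyX K (mnm1 i)) | i < m] Q.
have Q'E y : meval y Q' = meval (fun i => x0 i + y i) Q.
  rewrite comp_mpoly_meval; apply: meval_eq => i.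
  by rewrite tnth_mktuple mevalD mevalC mevalXU.
have Q'0 : Q' != 0.
  have [v Qv] := meval_neq0 Q0; apply: contra_neq Qv => Q'0.
  have := Q'E (fun i => v i - x0 i); rewrite Q'0 meval0 => H; rewrite [RHS]H.
  by apply: meval_eq => i; rewrite subrKC.
pose p j := pihomog mdeg j Q'.
have pE : Q' = \sum_(j < msize Q') p j by exact: pihomog_partitionE.
have exd : exists d, p d != 0.
  apply: contrapT => no; move: Q'0; rewrite pE big1 ?eqxx // => j _.
  by apply/eqP/negPn/negP => pj; apply: no; exists j.
pose d := ex_minn exd.
have [pd dmin] : p d != 0 /\ forall j, p j != 0 -> (d <= j)%N by rewrite /d; case: ex_minnP.
have p0 j : (j < d)%N -> p j = 0.
  by move=> jd; apply/eqP/negPn/negP => /dmin; rewrite leqNgt jd.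
have phom j t y : meval (fun i => t * y i) (p j) = t ^+ j * meval y (p j).
  rewrite /p pihomogE !raddf_sum /= mulr_sumr; apply: eq_bigr => e /eqP <-.
  rewrite !mevalZ !mevalX mulrCA; congr (_ * _); rewrite mdegE -prodrXr -big_split /=.
  by apply: eq_bigr => i _; rewrite exprMn.
have [w pw] := meval_neq0 pd.
(* Coordinate 0 of [z] is [t] and the others are [y]. [S] extends [Q'(t y) / t ^+ d] continuously to
   [t = 0], where it equals [p d] at [y]. The truncated [j - d] does no harm, since [p j = 0] for
   [j < d]. *)
pose Y (z : 'rV[K]_m.+1) (i : 'I_m) := z 0 (lift ord0 i).
pose S (z : 'rV[K]_m.+1) := \sum_(j <- iota 0 (msize Q')) (z 0 ord0) ^+ (j - d) * meval (Y z) (p j).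
have dlt : (d < msize Q')%N.
  rewrite ltnNge; apply/negP => h; move: pd; rewrite /p pihomogE big_seq_cond big1 ?eqxx //.
  by move=> e /andP[/msize_mdeg_lt he /eqP ed]; move: he; rewrite ed ltnNge h.
pose z0 : 'rV[K]_m.+1 := \row_j (if unlift ord0 j is Some i then w i else 0).
have Sd : differentiable S z0.
  apply: differentiable_sum_seq => j; apply: differentiable_mul.
    by apply: differentiable_exp; exact: differentiable_coord.
  by apply: differentiable_meval => i; exact: differentiable_coord.
have Sz0 : S z0 != 0.
  rewrite /S (bigD1_seq d) ?mem_iota ?iota_uniq ?add0n //= subnn expr0 mul1r big_seq_cond big1 ?addr0.
    by rewrite (@meval_eq _ _ _ w) // => i; rewrite /Y /z0 mxE liftK.
  move=> j /andP[_ jd]; rewrite /z0 mxE unlift_none.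
  case: (ltngtP j d) jd => // [/p0 ->|dj] _; first by rewrite meval0 mulr0.
  by rewrite expr0n subn_eq0 leqNgt dj mul0r.
have Snear : \forall z \near z0, S z != 0.
  exact: (cvgr_neq0 _ (differentiable_continuous Sd) Sz0).
have [e /= e0 He] := (nbhs_ballP _ _).1 Snear.
exists w, e; split => // t y t0 te ye.
have SE : meval (fun i => x0 i + t * y i) Q =
    t ^+ d * S (\row_j (if unlift ord0 j is Some i then y i else t)).
  rewrite -(Q'E (fun i => t * y i)) {1}pE raddf_sum /= /S mulr_sumr.
  rewrite -(big_mkord xpredT (fun j => meval (fun i => t * y i) (p j))) /index_iota subn0.
  apply: eq_bigr => j _; rewrite phom mxE unlift_none mulrA.
  rewrite (@meval_eq _ _ (Y _) y); last by move=> i; rewrite /Y mxE liftK.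
  have [jd|dj] := ltnP j d; first by rewrite p0 // meval0 !mulr0.
  by rewrite -exprD subnKC.
rewrite SE; apply: mulf_neq0; [exact: expf_neq0|apply: He; split => // i j].
rewrite /ball /= !mxE; case: (unlift ord0 j) => [k|]; first by rewrite /ball_ distrC; exact: ye.
by rewrite /ball_ sub0r normrN.
Qed.

End CharZero.

(** * The addition theorem *)

Section Shift.
Variables (R : realType) (n : nat).
Local Notation C := (CC R).
Local Notation Cn := 'rV[C]_n.
Implicit Types (f g h : Cn -> C) (a u v b : Cn).

Lemma near_shiftD (P : Cn -> Prop) u b :
  (\forall v \near (u + b), P v) -> \forall v \near u, P (v + b).
Proof.
move=> /near_nrmP[d d0 H]; apply/near_nrmP; exists d => // v vu; apply: H.
by rewrite opprD addrACA subrr addr0.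
Qed.

Lemma differentiable_shift f u b : differentiable f (u + b) ->
  differentiable (fun v => f (v + b)) u.
Proof.
move=> fd.
have d1 : differentiable (fun v : Cn => v + b) u.
  have did : differentiable (id : Cn -> Cn) u by have [] := is_diff_id u.
  exact: (differentiableD did (differentiable_cst b u)).
exact: (@differentiable_comp _ Cn Cn C (fun v : Cn => v + b) f u d1 fd).
Qed.

Lemma holomorphic_shift f u b : holomorphic_at f (u + b) <-> holomorphic_at (fun v => f (v + b)) u.
Proof.
have H g w c : holomorphic_at g (w + c) -> holomorphic_at (fun v => g (v + c)) w.
  move=> hg; have [d d0 Hd] := (near_nrmP _ _).1 (@near_shiftD (fun v => differentiable g v) w c hg).
  apply/near_nrmP; exists d; first exact: d0.
  by move=> v vd; exact: differentiable_shift (Hd v vd).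
split=> [/H //|fu]; have := H (fun v => f (v + b)) (u + b) (- b).
rewrite addrK => /(_ fu); rewrite (_ : (fun v => f (v - b + b)) = f) //.
by apply/funext => v; rewrite subrK.
Qed.

Lemma meromorphic_shift f b : meromorphic f -> meromorphic (fun v => f (v + b)).
Proof.
move=> fm a; have [g [h [gh hh h0 fE]]] := fm (a + b).
exists (fun v => g (v + b)), (fun v => h (v + b)); split.
- exact/holomorphic_shift.
- exact/holomorphic_shift.
- move=> z; apply: h0; rewrite -(addrK b a) in z *.
  have := @near_shiftD (fun v => h (v + b) = 0) (a + b) (- b) z.
  rewrite addrK => z'; have [d d0 H] := (near_nrmP _ _).1 z'.
  apply/near_nrmP; exists d; first exact: d0.
  by move=> v /H; rewrite subrK.
- exact: (@near_shiftD (fun v => h v != 0 -> f v = g v / h v)).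
Qed.

Lemma holomorphic_cst (c : C) a : holomorphic_at (fun=> c) a.
Proof.
apply/near_nrmP; exists 1; first exact: ltr01.
by move=> v _; exact: differentiable_cst.
Qed.

Lemma meromorphic_cst (c : C) : meromorphic (fun _ : Cn => c).
Proof.
move=> a; exists (fun=> c), (fun=> 1); split; [exact: holomorphic_cst|exact: holomorphic_cst| |].
  by move=> /nbhs_singleton /eqP; rewrite oner_eq0.
apply/near_nrmP; exists 1; first exact: ltr01.
by move=> v _ _; rewrite divr1.
Qed.

Lemma dense_good (I : finType) (f : I -> Cn -> C) : (forall i, meromorphic (f i)) ->
  dense_pred (fun u => forall i, holomorphic_at (f i) u).
Proof.
move=> fm a d d0.
have [||||v va [_ Hv]] := @dense_and_open R n I (enum I) (fun i => holomorphic_at (f i)) a 1 _ _ a d.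
- by move=> i u; exact: holomorphic_near.
- by move=> i u e _ e0; exact: (meromorphic_dense_holomorphic (fm i)).
- by rewrite subrr nrm0.
- exact: d0.
by exists v => // i; apply: Hv; rewrite mem_enum.
Qed.

End Shift.

(** * Families of functions substituted into a relation *)

Section AATFamily.
Variables (R : realType) (n : nat).
Local Notation C := (CC R).
Local Notation Cn := 'rV[C]_n.

Definition lam : 'I_(1 + (n + n)) := lshift (n + n) ord0.
Definition xidx (p : 'I_n) : 'I_(1 + (n + n)) := rshift 1 (lshift n p).
Definition yidx (p : 'I_n) : 'I_(1 + (n + n)) := rshift 1 (rshift n p).

Lemma aat_idxP (P : 'I_(1 + (n + n)) -> Prop) :
  P lam -> (forall p, P (xidx p)) -> (forall p, P (yidx p)) -> forall i, P i.
Proof.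
move=> P0 Px Py i; case: (split_ordP i) => j ->; first by rewrite (ord1 j).
by case: (split_ordP j) => k ->; [exact: Px|exact: Py].
Qed.

Lemma aat_lam (l : C) x y : aat_point l x y lam = l.
Proof. by rewrite /aat_point (unsplitK (inl _)). Qed.
Lemma aat_x (l : C) x y p : aat_point l x y (xidx p) = x p.
Proof. by rewrite /aat_point (unsplitK (inr _)) (unsplitK (inl _)). Qed.
Lemma aat_y (l : C) x y p : aat_point l x y (yidx p) = y p.
Proof. by rewrite /aat_point (unsplitK (inr _)) (unsplitK (inr _)). Qed.

(** Taking [X] or [Y] constant freezes [u] or [v], which turns a relation in [(u, v)] into one on
    [C^n], where the identity theorem applies. *)
Definition aat_good (a : Cn -> C) (X Y : 'I_n -> Cn -> C) (t : Cn) : Prop :=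
  [/\ holomorphic_at a t, forall j, holomorphic_at (X j) t & forall j, holomorphic_at (Y j) t].

Variables (a : Cn -> C) (X Y : 'I_n -> Cn -> C) (Q : mpoly (1 + (n + n)) C).

Let fam i t := aat_point (a t) (X^~ t) (Y^~ t) i.

Let famE : (fam lam = a) * (forall p, fam (xidx p) = X p) * (forall p, fam (yidx p) = Y p).
Proof.
by split; [split|]; [|move=> p..]; apply/funext => t; rewrite /fam ?aat_lam ?aat_x ?aat_y.
Qed.

Let aat_goodE t : aat_good a X Y t <-> forall i, holomorphic_at (fam i) t.
Proof.
split=> [[ha hX hY]|H]; first by apply: aat_idxP => [|p|p]; rewrite famE.
split; first by rewrite -famE.
  by move=> p; have := H (xidx p); rewrite famE.
by move=> p; have := H (yidx p); rewrite famE.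
Qed.

Lemma aat_open t : aat_good a X Y t -> meval (aat_point (a t) (X^~ t) (Y^~ t)) Q != 0 ->
  \forall u \near t, aat_good a X Y u /\ meval (aat_point (a u) (X^~ u) (Y^~ u)) Q != 0.
Proof.
move=> /aat_goodE gt qt; have [d d0 H] := (near_nrmP _ _).1 (good_neq0_open gt qt).
by apply/near_nrmP; exists d => // u /H[gu qu]; split => //; apply/aat_goodE.
Qed.

Lemma aat_dense t : meromorphic a -> (forall j, meromorphic (X j)) -> (forall j, meromorphic (Y j)) ->
  aat_good a X Y t -> meval (aat_point (a t) (X^~ t) (Y^~ t)) Q != 0 ->
  dense_pred (fun u => aat_good a X Y u /\ meval (aat_point (a u) (X^~ u) (Y^~ u)) Q != 0).
Proof.
move=> am Xm Ym /aat_goodE gt qt b d d0.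
have fm i : meromorphic (fam i) by move: i; apply: aat_idxP => [|p|p]; rewrite famE.
have [u ub [gu qu]] := dense_nonvanishing fm gt qt b d0.
by exists u => //; split => //; apply/aat_goodE.
Qed.

End AATFamily.

(** * Analytic independence and minimal relations *)

Section Independence.
Variables (R : realType) (n : nat).
Local Notation C := (CC R).
Local Notation Cn := 'rV[C]_n.
Variable phi : 'I_n -> Cn -> C.
Hypothesis phi_mero : forall k, meromorphic (phi k).
Hypothesis phi_indep : analytically_independent phi.

Definition good (u : Cn) : Prop := forall k, holomorphic_at (phi k) u.

Lemma jacobian_surjective (u : Cn) (w : 'I_n -> C) : good u -> \det (jacobian_mx phi u) != 0 ->
  exists v : Cn, forall k, 'D_v (phi k) u = w k.
Proof.
move=> gu ju; pose J := jacobian_mx phi u.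
have Ju : J \in unitmx by rewrite unitmxE unitfE.
exists (invmx J *m \col_k w k)^T => k.
set v := (_)^T; have dk := holomorphic_differentiable (gu k).
rewrite deriveE // {1}(row_sum_delta v) linear_sum /=.
transitivity ((J *m (invmx J *m \col_k w k)) k 0); last by rewrite mulKVmx // mxE.
rewrite mxE; apply: eq_bigr => p _.
by rewrite linearZ /= -deriveE // /J !mxE /partial mulrC.
Qed.

Lemma near_quotient (u v : Cn) (w : 'I_n -> C) (e : C) : good u -> (forall k, 'D_v (phi k) u = w k) -> 0 < e ->
  \forall t \near 0^', forall k, `|t^-1 * (phi k (u + t *: v) - phi k u) - w k| < e.
Proof.
move=> gu Dw e0; apply: filter_forall => k.
have dk : derivable (phi k) u v by apply: diff_derivable; exact: holomorphic_differentiable.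
have /cvgrPdist_lt/(_ e e0) := dk; rewrite -/(derive _ _ _) Dw.
apply: filter_app; apply: nearW => t; rewrite distrC.
by rewrite /= [t *: v + u]addrC.
Qed.

Lemma near_line (u v : Cn) (P : Cn -> Prop) : (\forall z \near u, P z) ->
  \forall t \near 0^', P (u + (t : C) *: v).
Proof.
move=> /near_nrmP[d d0 H].
have h : 0 < d / (nrm v + 1) by rewrite divr_gt0 // ltr_wpDl ?nrm_ge0.
have : \forall t \near (0 : C), P (u + t *: v).
  apply/near_nrmP; exists (d / (nrm v + 1)) => // t; rewrite subr0 => ht; apply: H.
  rewrite addrAC subrr add0r nrmZ; apply: (@le_lt_trans _ _ (nrm t * (nrm v + 1))).
    by apply: ler_wpM2l; [exact: nrm_ge0|rewrite lerDl].
  by rewrite -ltr_pdivlMr // ltr_wpDl ?nrm_ge0.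
exact: nbhs_dnbhs.
Qed.

Definition lam_free (Q : mpoly (1 + (n + n)) C) : Prop := forall e, e \in msupp Q -> e (lam n) = 0%N.

Lemma meval_lam_free Q (l l' : C) x y : lam_free Q ->
  meval (aat_point l x y) Q = meval (aat_point l' x y) Q.
Proof.
move=> Qf; rewrite !mevalE; apply: eq_big_seq => e eQ; congr (_ * _); apply: eq_bigr => i _.
by move: i; apply: aat_idxP => [|p|p]; rewrite ?aat_lam ?aat_x ?aat_y // Qf // !expr0.
Qed.

(** The invertible Jacobian at [u0] realizes every first-order variation of [phi]. Moving [u] and
    [v] away from [u0] along suitable lines makes [(phi u, phi v)] leave its initial value in a
    direction in which [Q] is nonzero. *)
Lemma lam_free_nonvanishing Q : Q != 0 -> lam_free Q ->
  exists u v, [/\ good u, good v, good (u + v) &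
    forall l, meval (aat_point l (phi^~ u) (phi^~ v)) Q != 0].
Proof.
move=> Q0 Qf; have [u0 [g0 j0]] := phi_indep.
have [w [e [e0 He]]] := meval_neq0_direction (aat_point 0 (phi^~ u0) (phi^~ u0)) Q0.
have [v1 D1] := jacobian_surjective (fun p => w (xidx p)) g0 j0.
have [v2 D2] := jacobian_surjective (fun p => w (yidx p)) g0 j0.
have gn : \forall z \near u0, good z.
  by apply: nbhs_forall => i; exact: holomorphic_near.
have te : \forall t \near (0 : C)^', `|t| < e by exact: dnbhs0_lt.
have t0 : \forall t \near (0 : C)^', t != 0 by exact: nbhs_dnbhs_neq.
have q1 := near_quotient g0 D1 e0.
have q2 := near_quotient g0 D2 e0.
have n1 := near_line v1 gn.
have n2 := near_line v2 gn.
have [t [[[tn te'] [k1 k2]] [gu gv]]] := filter_ex (filterI (filterI (filterI t0 te) (filterI q1 q2)) (filterI n1 n2)).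
set u := u0 + t *: v1 in gu; set v := u0 + t *: v2 in gv.
have qn l : meval (aat_point l (phi^~ u) (phi^~ v)) Q != 0.
  (* The lambda coordinate is free, so it is given the value [t * w (lam n)] that the direction
     prescribes. *)
  have /= := He t (aat_point (w (lam n)) (fun k => t^-1 * (phi k u - phi k u0)) (fun k => t^-1 * (phi k v - phi k u0))) tn te'.
  rewrite (meval_lam_free l (t * w (lam n)) _ _ Qf).
  rewrite (@meval_eq _ _ _ (aat_point (t * w (lam n)) (phi^~ u) (phi^~ v))).
    apply; apply: aat_idxP => [|p|p]; rewrite ?aat_lam ?aat_x ?aat_y; [by rewrite subrr normr0|exact: k1|exact: k2].
  apply: aat_idxP => [|p|p]; rewrite ?aat_lam ?aat_x ?aat_y; first by rewrite add0r.
    by rewrite mulVKf // subrKC.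
  by rewrite mulVKf // subrKC.
(* [u + v] may still be a bad point. A small move of [u] corrects this and keeps [Q] nonzero. *)
have [|d d0 Hd] := (near_nrmP _ _).1 (@aat_open R n (fun=> 0) phi (fun j _ => phi j v) Q u _ (qn 0)).
  by split; [exact: holomorphic_cst|exact: gu|move=> j; exact: holomorphic_cst].
have [z zd zg] := dense_good (fun k => meromorphic_shift v (phi_mero k)) u d0.
have [[_ gz _] qz] := Hd z zd.
exists z, v; split; [exact: gz|exact: gv| |].
  by move=> k; apply/holomorphic_shift; exact: zg.
by move=> l; rewrite (meval_lam_free l 0 _ _ Qf); exact: qz.
Qed.

Definition pair_good k u v := [/\ good u, good v & holomorphic_at (phi k) (u + v)].

Definition ev k Q u v := meval (aat_point (phi k (u + v)) (phi^~ u) (phi^~ v)) Q.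

Definition relation k Q := forall u v, pair_good k u v -> ev k Q u v = 0.

(* A relation of minimal degree: its derivative in lambda is a nonzero
   polynomial of smaller degree, so it is not a relation. *)
Lemma minimal_relation k : (exists2 G, G != 0 & relation k G) ->
  exists Q, [/\ Q != 0, relation k Q &
    exists u v, pair_good k u v /\ ev k (mderiv (lam n) Q) u v != 0].
Proof.
move=> [G G0 Grel].
have exm : exists m, `[< exists Q, [/\ Q != 0, relation k Q & msize Q = m] >].
  by exists (msize G); apply/asboolP; exists G.
case: (ex_minnP exm) => m /asboolP[Q [Q0 Qrel Qm]] min; exists Q; split => //.
apply: contrapT => no.
have Drel : relation k (mderiv (lam n) Q).
  by move=> u v uv; apply/eqP/negPn/negP => h; apply: no; exists u, v.
have [D0|D0] := eqVneq (mderiv (lam n) Q) 0; last first.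
  have : (m <= msize (mderiv (lam n) Q))%N by apply: min; apply/asboolP; exists (mderiv (lam n) Q).
  by rewrite leqNgt -Qm msize_mderiv_lt.
(* A zero derivative would make [Q] a relation between [phi u] and [phi v] alone, against analytic
   independence. *)
have Qf : lam_free Q by move=> e; exact: (mderiv_eq0 D0).
have [u [v [gu gv guv Quv]]] := lam_free_nonvanishing Q0 Qf.
by have := Quv (phi k (u + v)); rewrite -[meval _ _]/(ev k Q u v) Qrel ?eqxx.
Qed.

End Independence.

(** * Relations as polynomials in lambda *)

Section LamCoef.
Variables (R : realType) (n : nat).
Local Notation C := (CC R).
Local Notation lam := (lam n).
Implicit Types Q : mpoly (1 + (n + n)) C.

Definition drop_lam (e : multinom (1 + (n + n))) : multinom (1 + (n + n)) :=
  Multinom [tuple (if i == lam then 0%N else e i) | i < 1 + (n + n)].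

(** Coefficients stay in all [1 + (n + n)] variables, with exponent 0 in lambda, so that [aat_point]
    still applies to them. *)
Definition lam_coef Q (j : nat) : mpoly (1 + (n + n)) C :=
  \sum_(e <- msupp Q | e lam == j) mcoeff e Q *: mpolyX C (drop_lam e).

Definition lam_deg Q : nat := \max_(e <- msupp Q) e lam.

Lemma lam_degP Q e : e \in msupp Q -> (e lam <= lam_deg Q)%N.
Proof. by move=> eQ; rewrite /lam_deg (bigD1_seq e) ?msupp_uniq //= leq_maxl. Qed.

Lemma drop_lam_inj (e e' : multinom (1 + (n + n))) : e lam = e' lam -> drop_lam e = drop_lam e' -> e = e'.
Proof.
move=> el /mnmP H; apply/mnmP => i; have := H i; rewrite !mnmE.
by case: eqP => // -> _.
Qed.

Lemma mcoeff_lam_coef Q j e : mcoeff e (lam_coef Q j) =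
  \sum_(e' <- msupp Q | e' lam == j) mcoeff e' Q * (drop_lam e' == e)%:R.
Proof. by rewrite raddf_sum /=; apply: eq_bigr => e' _; rewrite mcoeffZ mcoeffX. Qed.

Lemma lam_coef_free Q j : lam_free (lam_coef Q j).
Proof.
move=> e; rewrite mcoeff_msupp mcoeff_lam_coef => h; apply/eqP/negPn/negP => el.
move: h; rewrite big1 ?eqxx // => e' _; case: eqP => [E|]; last by rewrite mulr0.
by move: el; rewrite -E mnmE eqxx.
Qed.

Lemma lam_coef_lead_neq0 Q : Q != 0 -> lam_coef Q (lam_deg Q) != 0.
Proof.
move=> Q0.
have [e eQ el] : exists2 e, e \in msupp Q & e lam = lam_deg Q.
  have : msupp Q != [::] by rewrite msupp_eq0.
  rewrite /lam_deg; elim: (msupp Q) => // e s IH _; rewrite big_cons.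
  have [->|/IH[e' e's e'l]] := eqVneq s [::].
    by exists e; rewrite ?mem_head // big_nil maxn0.
  rewrite -e'l; case: (leqP (e lam) (e' lam)) => h.
    by exists e'; rewrite ?inE ?e's ?orbT //; apply/esym/maxn_idPr.
  by exists e; rewrite ?mem_head //; apply/esym/maxn_idPl; exact: ltnW.
apply/eqP => /(congr1 (mcoeff (drop_lam e))); rewrite mcoeff0 mcoeff_lam_coef.
rewrite -big_filter (bigD1_seq e) /=; first last.
- by rewrite filter_uniq // msupp_uniq.
- by rewrite mem_filter el eqxx.
rewrite eqxx mulr1 big_seq_cond big1 ?addr0.
  by move/eqP; rewrite mcoeff_eq0 eQ.
move=> e' /andP[]; rewrite mem_filter => /andP[/eqP e'l e'Q] ne.
case: eqP => [/drop_lam_inj E|]; last by rewrite mulr0.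
by move: ne; rewrite E ?eqxx // e'l el.
Qed.

Lemma meval_lam_coef Q (l : C) x y : meval (aat_point l x y) Q =
  \sum_(j < (lam_deg Q).+1) meval (aat_point 0 x y) (lam_coef Q j) * l ^+ j.
Proof.
transitivity (\sum_(j < (lam_deg Q).+1) \sum_(e <- msupp Q | e lam == j)
   mcoeff e Q * \prod_i aat_point l x y i ^+ e i); last first.
  apply: eq_bigr => j _; rewrite raddf_sum /= mulr_suml; apply: eq_bigr => e /eqP ej.
  rewrite mevalZ mevalX -mulrA; congr (_ * _).
  rewrite (bigD1 lam) //= [in RHS](bigD1 lam) //= aat_lam mnmE eqxx expr0 mul1r ej mulrC.
  congr (_ * _); apply: eq_bigr; apply: aat_idxP => [|p|p] il.
  - by rewrite eqxx in il.
  - by rewrite mnmE (negPf il) !aat_x.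
  - by rewrite mnmE (negPf il) !aat_y.
rewrite mevalE (exchange_big_dep xpredT) //= big_seq [in RHS]big_seq.
apply: eq_bigr => e eQ.
have elt : (e lam < (lam_deg Q).+1)%N by rewrite ltnS lam_degP.
by rewrite (big_pred1 (Ordinal elt)) // => j; rewrite eq_sym.
Qed.

(** Multiplication by a power of [l] brings all relations to the common degree [d] used in the
    elimination; the leading coefficient is unchanged. *)
Lemma meval_lam_coef_shift Q (d : nat) (l : C) x y : (lam_deg Q <= d)%N ->
  \sum_(j < d.+1) (if (d - lam_deg Q <= j)%N
     then meval (aat_point 0 x y) (lam_coef Q (j - (d - lam_deg Q))) else 0) * l ^+ j =
  l ^+ (d - lam_deg Q) * meval (aat_point l x y) Q.
Proof.
move=> dQ; set r := (d - lam_deg Q)%N.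
have dE : d.+1 = (r + (lam_deg Q).+1)%N by rewrite addnS subnK.
rewrite dE big_split_ord /= big1 ?add0r => [|j _]; last by rewrite leqNgt ltn_ord mul0r.
rewrite meval_lam_coef mulr_sumr; apply: eq_bigr => j _.
by rewrite leq_addr addKn exprD mulrCA.
Qed.

End LamCoef.

(** * Generic translation and algebraic dependence *)

Section Main.
Variables (R : realType) (n : nat).
Local Notation C := (CC R).
Local Notation Cn := 'rV[C]_n.
Local Notation lam := (lam n).

Lemma dense_pred_all (I : finType) (P : I -> Cn -> Prop) :
  (forall i u, P i u -> \forall v \near u, P i v) -> (forall i, dense_pred (P i)) ->
  dense_pred (fun u => forall i, P i u).
Proof.
move=> Po Pd a d d0.
have [|||v va [_ Hv]] := @dense_and_open R n I (enum I) P a 1 Po _ a d.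
- by move=> i u e _ e0; exact: Pd.
- by rewrite subrr nrm0.
- exact: d0.
by exists v => // i; apply: Hv; rewrite mem_enum.
Qed.

Variable phi : 'I_n -> Cn -> C.
Hypothesis phi_mero : forall k, meromorphic (phi k).

(** Failure of the relation at a point of holomorphy persists nearby and would meet [D]. *)
Lemma dense_alg_dependent m (f : 'I_m -> Cn -> C) (P : mpoly m C) (D : Cn -> Prop) :
  dense_pred D -> (forall u, D u -> meval (f^~ u) P = 0) ->
  forall u, (forall i, holomorphic_at (f i) u) -> meval (f^~ u) P = 0.
Proof.
move=> Dd DP u fu; apply/eqP/negPn/negP => Pu.
have [d d0 H] := (near_nrmP _ _).1 (good_neq0_open fu Pu).
have [v vu Dv] := Dd u d d0.
by have [_] := H v vu; rewrite DP ?eqxx.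
Qed.

(** Differentiation in [v] along ['e_p] at [v = b]. As [u] is fixed, the [x] variables contribute
    nothing, and the [y] variables contribute derivatives at the fixed point [b]. *)
Lemma derive_relation k Q u b p : relation phi k Q -> pair_good phi k u b ->
  partial p (phi k) (u + b) * ev phi k (mderiv lam Q) u b =
  - \sum_j ev phi k (mderiv (yidx j) Q) u b * partial p (phi j) b.
Proof.
move=> Qrel [gu gb gub].
pose F i (v : Cn) := aat_point (phi k (u + v)) (phi^~ u) (phi^~ v) i.
pose dF i := aat_point (partial p (phi k) (u + b)) (fun=> 0) (fun j => partial p (phi j) b) i.
have Dphi j w : holomorphic_at (phi j) w -> is_derive w 'e_p (phi j) (partial p (phi j) w).
  by move=> h; apply: derivableP; apply: diff_derivable; exact: holomorphic_differentiable.
have FD i : is_derive b 'e_p (F i) (dF i).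
  move: i; apply: aat_idxP => [|j|j].
  - rewrite (_ : F lam = fun v => phi k (v + u)); last first.
      by apply/funext => v; rewrite /F aat_lam addrC.
    rewrite /dF aat_lam; have [h1 h2] := Dphi k _ gub.
    have E : (fun h : C => h^-1 *: (((fun v => phi k (v + u)) \o shift b) (h *: 'e_p) - phi k (b + u))) =
             (fun h : C => h^-1 *: ((phi k \o shift (u + b)) (h *: 'e_p) - phi k (u + b))).
      by apply/funext => h /=; rewrite -addrA (addrC b u).
    by apply: DeriveDef; [rewrite /derivable E|rewrite /derive E].
  - rewrite (_ : F (xidx j) = cst (phi j u)); last by apply/funext => v; rewrite /F aat_x.
    by rewrite /dF aat_x; exact: is_derive_cst.
  - rewrite (_ : F (yidx j) = phi j); last by apply/funext => v; rewrite /F aat_y.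
    by rewrite /dF aat_y; exact: Dphi.
have [_ HD] := is_derive_meval Q FD.
have F0 : \forall v \near b, meval (F^~ v) Q = (cst 0 : Cn -> C) v.
  have h1 : \forall v \near b, good phi v.
    by apply: nbhs_forall => i; exact: holomorphic_near.
  have h2 : \forall v \near b, holomorphic_at (phi k) (v + u).
    by apply: near_shiftD; rewrite addrC; exact: holomorphic_near.
  apply: nbhsS2 h1 h2 => v gv hv; apply: Qrel; split; [exact: gu|exact: gv|].
  by rewrite addrC; exact: hv.
move: HD; rewrite (near_eq_derive _ F0) derive_cst => /esym.
rewrite big_split_ord /= big_ord1 big_split_ord /=.
rewrite [X in _ + (X + _)]big1 ?add0r; last by move=> j _; rewrite /dF aat_x mulr0.
rewrite -/lam /dF aat_lam => /eqP; rewrite addr_eq0 mulrC => /eqP ->; congr (- _).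
by apply: eq_bigr => j _; rewrite aat_y.
Qed.

Hypothesis phi_indep : analytically_independent phi.
Hypothesis phi_AAT : admits_AAT phi.

Lemma phi_and_partials_dependent (s : 'I_n.+1 -> 'I_n + 'I_n * 'I_n) :
  alg_dependent (fun i => phi_and_partials phi (s i)).
Proof.
have [G HG] := phi_AAT.
have /choice[Q HQ] : forall k, exists Q, [/\ Q != 0, relation phi k Q &
    exists u v, pair_good phi k u v /\ ev phi k (mderiv lam Q) u v != 0].
  move=> k; apply: minimal_relation => //; exists (G k); first by have [] := HG k.
  by move=> u v [gu gv guv]; have [_ H] := HG k; exact: (H u v gu gv guv).
have /choice[w1 Hw1] : forall k, exists w : Cn * Cn,
    pair_good phi k w.1 w.2 /\ ev phi k (mderiv lam (Q k)) w.1 w.2 != 0.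
  by move=> k; have [_ _ [u [v ?]]] := HQ k; exists (u, v).
pose cf k := lam_coef (Q k) (lam_deg (Q k)).
have /choice[w2 Hw2] : forall k, exists w : Cn * Cn, [/\ good phi w.1, good phi w.2 &
    meval (aat_point 0 (phi^~ w.1) (phi^~ w.2)) (cf k) != 0].
  move=> k; have [Q0 _ _] := HQ k.
  have [u [v [gu gv _ H]]] := lam_free_nonvanishing phi_mero phi_indep
    (lam_coef_lead_neq0 Q0) (@lam_coef_free _ _ (Q k) _).
  exists (u, v); split; [exact: gu|exact: gv|exact: H].
(* [(k, true)] keeps the denominator of the derivative formula nonzero, [(k, false)] the leading
   coefficient in lambda. Each condition, with [u] frozen at its own witness, is open and dense in
   [v], so one [b] serves all. *)
have [b Hb] : exists b, forall i : 'I_n * bool, if i.2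
    then pair_good phi i.1 (w1 i.1).1 b /\ ev phi i.1 (mderiv lam (Q i.1)) (w1 i.1).1 b != 0
    else good phi b /\ meval (aat_point 0 (phi^~ (w2 i.1).1) (phi^~ b)) (cf i.1) != 0.
  pose P (i : 'I_n * bool) v := if i.2
    then aat_good (fun v => phi i.1 (v + (w1 i.1).1)) (fun j _ => phi j (w1 i.1).1) phi v /\
      meval (aat_point (phi i.1 (v + (w1 i.1).1)) (phi^~ (w1 i.1).1) (phi^~ v)) (mderiv lam (Q i.1)) != 0
    else aat_good (fun=> 0) (fun j _ => phi j (w2 i.1).1) phi v /\
      meval (aat_point 0 (phi^~ (w2 i.1).1) (phi^~ v)) (cf i.1) != 0.
  have [|| b _ Hb] := @dense_pred_all _ P _ _ 0 1 ltr01.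
  - by move=> [k []] v [gv qv]; exact: (aat_open gv qv).
  - move=> [k []].
    + have [[gu gv guv] q] := Hw1 k.
      apply: (aat_dense (t := (w1 k).2)).
      * exact: (meromorphic_shift _ (phi_mero k)).
      * by move=> j; exact: meromorphic_cst.
      * exact: phi_mero.
      * split; [|by move=> j; exact: holomorphic_cst|exact: gv].
        by apply/holomorphic_shift; rewrite addrC; exact: guv.
      * by rewrite [_.2 + _]addrC; exact: q.
    + have [gu gv q] := Hw2 k.
      apply: (aat_dense (t := (w2 k).2)).
      * exact: meromorphic_cst.
      * by move=> j; exact: meromorphic_cst.
      * exact: phi_mero.
      * split; [exact: holomorphic_cst|by move=> j; exact: holomorphic_cst|exact: gv].
      * exact: q.
  exists b => -[k []].
  - have [[h1 _ h3] q] := Hb (k, true); have [[gu _ _] _] := Hw1 k.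
    rewrite /ev /pair_good addrC; split; last exact: q.
    by split; [exact: gu|exact: h3|apply/holomorphic_shift; exact: h1].
  - by have [[_ _ h3] q] := Hb (k, false); split; [exact: h3|exact: q].
have gb : good phi b by move=> k; have [/(_ k)] := Hb (k, false).
pose cond u := forall i : 'I_n * bool, if i.2
    then pair_good phi i.1 u b /\ ev phi i.1 (mderiv lam (Q i.1)) u b != 0
    else meval (aat_point 0 (phi^~ u) (phi^~ b)) (cf i.1) != 0.
(* The roles are exchanged: [b] is frozen, and the former witnesses show that no condition fails
   identically in [u]. *)
have cond_dense : dense_pred cond.
  pose P (i : 'I_n * bool) u := if i.2
    then aat_good (fun u => phi i.1 (u + b)) phi (fun j _ => phi j b) u /\
      meval (aat_point (phi i.1 (u + b)) (phi^~ u) (phi^~ b)) (mderiv lam (Q i.1)) != 0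
    else aat_good (fun=> 0) phi (fun j _ => phi j b) u /\
      meval (aat_point 0 (phi^~ u) (phi^~ b)) (cf i.1) != 0.
  move=> a d d0.
  have [|| u ua Hu] := @dense_pred_all _ P _ _ a d d0.
  - by move=> [k []] v [gv qv]; exact: (aat_open gv qv).
  - move=> [k []].
    + have [[gu _ guv] q] := Hb (k, true).
      apply: (aat_dense (t := (w1 k).1)).
      * exact: (meromorphic_shift _ (phi_mero k)).
      * exact: phi_mero.
      * by move=> j; exact: meromorphic_cst.
      * split; [by apply/holomorphic_shift; exact: guv|exact: gu|by move=> j; exact: holomorphic_cst].
      * exact: q.
    + have [gu _ _] := Hw2 k; have [_ q] := Hb (k, false).
      apply: (aat_dense (t := (w2 k).1)).
      * exact: meromorphic_cst.
      * exact: phi_mero.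
      * by move=> j; exact: meromorphic_cst.
      * split; [exact: holomorphic_cst|exact: gu|by move=> j; exact: holomorphic_cst].
      * exact: q.
  exists u; first exact: ua.
  move=> -[k []].
  - have [[h1 h2 _] q] := Hu (k, true); split; last exact: q.
    by split; [exact: h2|exact: gb|apply/holomorphic_shift; exact: h1].
  - by have [_ q] := Hu (k, false).
pose T := {u : Cn | cond u}.
pose x k (t : T) := phi k (sval t).
pose l k (t : T) := phi k (sval t + b).
have pg k (t : T) : pair_good phi k (sval t) b by have [] := svalP t (k, true).
(* A common degree for all [k]; the successor makes it positive. *)
pose d := (\sum_k lam_deg (Q k)).+1.
have d0 : (0 < d)%N by [].
have dQ k : (lam_deg (Q k) <= d)%N by rewrite /d (bigD1 k) //= ltnW // ltnS leq_addr.
pose h k (j : 'I_d.+1) (t : T) : C := if (d - lam_deg (Q k) <= j)%N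
  then meval (aat_point 0 (x^~ t) (phi^~ b)) (lam_coef (Q k) (j - (d - lam_deg (Q k)))) else 0.
have h_rel k t : \sum_j h k j t * l k t ^+ j = 0.
  rewrite meval_lam_coef_shift //; have [_ Qrel _] := HQ k.
  by rewrite -[meval _ _]/(ev phi k (Q k) (sval t) b) Qrel ?mulr0 //; exact: pg.
have h_mult (k : 'I_n) (j : 'I_d.+1) : multiplier d x l (h k j).
  rewrite /h; case: (d - lam_deg (Q k) <= j)%N; last exact: multiplierC.
  apply: (multiplier_meval d0 (psi := fun i t => aat_point 0 (x^~ t) (phi^~ b) i)).
  apply: aat_idxP => [|p|p].
  - by apply: multiplier_ext (multiplierC d x l 0) => t; rewrite aat_lam.
  - by apply: multiplier_ext (multiplier_x x l d0 p) => t; rewrite aat_x.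
  - by apply: multiplier_ext (multiplierC d x l (phi p b)) => t; rewrite aat_y.
pose smul := smultiplier x l h.
have smulC c : smul (fun=> c) by apply: smultiplierW; exact: multiplierC.
have smul_ev k q : smul (fun t => ev phi k q (sval t) b).
  apply: (smultiplier_meval d0 h_mult (psi := fun i t => aat_point (l k t) (x^~ t) (phi^~ b) i)).
  apply: aat_idxP => [|p|p].
  - by apply: smultiplier_ext (smultiplier_l h_mult h_rel k) => t; rewrite aat_lam.
  - by apply: smultiplier_ext (smultiplierW _ (multiplier_x x l d0 p)) => t; rewrite aat_x.
  - by apply: smultiplier_ext (smulC (phi p b)) => t; rewrite aat_y.
pose f i (t : T) := phi_and_partials phi (s i) (sval t + b).
(* Numerator and denominator of each translated function: [l k / 1] for [phi k], the quotient of
   [derive_relation] for a derivative. *)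
have /choice[AB HAB] : forall i, exists AB : (T -> C) * (T -> C),
   [/\ smul AB.1, smul AB.2, forall t, f i t * AB.2 t = AB.1 t & forall t, AB.2 t != 0].
  move=> i; rewrite /f; case: (s i) => [k|[k p]] /=.
    exists (l k, fun=> 1); split => /=; [|exact: smulC| |].
    - exact: (smultiplier_l h_mult h_rel).
    - by move=> t; rewrite mulr1.
    - by move=> t; exact: oner_neq0.
  pose A (t : T) : C :=
    -1 * \sum_j ev phi k (mderiv (yidx j) (Q k)) (sval t) b * partial p (phi j) b.
  pose B (t : T) : C := ev phi k (mderiv lam (Q k)) (sval t) b.
  exists (A, B); split; rewrite /A /B /=.
  - apply: smultiplierM; first exact: smulC.
    elim: (index_enum _) => [|j r IH].
      by apply: smultiplier_ext (smulC 0) => t; rewrite big_nil.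
    have hj : smul (fun t => ev phi k (mderiv (yidx j) (Q k)) (sval t) b * partial p (phi j) b).
      by apply: smultiplierM; [exact: smul_ev|exact: smulC].
    have hD := smultiplierD d0 h_mult hj IH.
    by apply: smultiplier_ext hD => t; rewrite big_cons.
  - exact: smul_ev.
  - by move=> t; have [_ Qrel _] := HQ k; rewrite (derive_relation p Qrel (pg k t)) mulN1r.
  - by move=> t; have [] := svalP t (k, true).
have [||| P [P0 HP]] := @elimination _ _ _ d x l d0 h h_mult f (fun i => (AB i).1) (fun i => (AB i).2).
- by move=> i; have [] := HAB i.
- by move=> i; have [] := HAB i.
- by move=> i; have [] := HAB i.
exists P; split => //.
(* Elimination gives the relation at [u + b] for [u] satisfying [cond]; translation by [b] preserves
   density. *)
apply: (@dense_alg_dependent _ _ _ (fun v => cond (v - b))).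
  move=> a e e0; have [u ua cu] := cond_dense (a - b) e e0.
  exists (u + b); last by rewrite addrK.
  by move: ua; rewrite opprB addrA.
move=> v cv; pose t : T := exist _ (v - b) cv.
have := HP t; rewrite /f /= subrK; apply.
- move=> k; rewrite /h /= leq_subr subKn //.
  by have := cv (k, false).
- by move=> i; have [_ _ _] := HAB i; apply.
Qed.

End Main.

Local Close Scope complex_scope.
Local Close Scope classical_set_scope.

Theorem theorem1 (R : realType) (n : nat) (phi : 'I_n -> 'rV[CC R]_n -> CC R)
    (phi_mero : forall k : 'I_n, meromorphic (phi k))
    (phi_indep : analytically_independent phi)
    (phi_AAT : admits_AAT phi) :
  [/\ forall s : 'I_n.+1 -> 'I_n + 'I_n * 'I_n, injective s ->
        alg_dependent (fun i => phi_and_partials phi (s i)),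
      forall k : 'I_n,
        alg_dependent_on (phi k) (fun p : 'I_n => partial p (phi k))
    & forall k p : 'I_n, alg_dependent_on (partial p (phi k)) phi].
Proof.
have dep := phi_and_partials_dependent phi_mero phi_indep phi_AAT.
split=> [s _|k|k p]; first exact: dep.
- have := dep (fun i => oapp (fun p => inr (k, p)) (inl k) (unlift ord0 i)).
  rewrite /alg_dependent_on; congr alg_dependent.
  by apply/funext => i; case: (unlift ord0 i).
- have := dep (fun i => oapp inl (inr (k, p)) (unlift ord0 i)).
  rewrite /alg_dependent_on; congr alg_dependent.
  by apply/funext => i; case: (unlift ord0 i).
Qed.
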